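(* Suppose that $1<p<\infty$ and let $\mu$ be a finite positive Borel measure on $[0,1)$ such that the operator $\mathcal{H}_\mu$ is bounded from $B^p$ into itself. Then $\mu$ is a $\left(1-\frac{1}{p}\right)$-logarithmic $1$-Carleson measure.
   Context: $\mathbb{D}$ is the open unit disc in $\mathbb{C}$. For a finite positive Borel measure $\mu$ on $[0,1)$ and $n=0,1,2,\dots$, let $\mu_n=\int_{[0,1)}t^n\,d\mu(t)$. For $f(z)=\sum_{k=0}^\infty a_kz^k$ analytic in $\mathbb{D}$, define $$\mathcal{H}_\mu(f)(z)=\sum_{n=0}^\infty\left(\sum_{k=0}^\infty \mu_{n+k}a_k\right)z^n$$ whenever the right hand side makes sense (i.e. the inner series converge for all $n$) and defines an analytic function in $\mathbb{D}$. Saying that $\mathcal{H}_\mu$ is bounded from $X$ into itself includes that it is well defined on every $f\in X$. For $1<p<\infty$, the analytic Besov space $B^p$ is the space of all $f$ analytic in $\mathbb{D}$ with $$\rho_p(f)=\left(\int_{\mathbb{D}}(1-|z|^2)^{p-2}|f'(z)|^p\,dA(z)\right)^{1/p}<\infty,$$ where $dA(z)=\frac{dx\,dy}{\pi}$; it is normed by $|f(0)|+\rho_p(f)$. For $\alpha\ge 0$ and $s>0$, a positive Borel measure $\mu$ on $[0,1)$ is an $\alpha$-logarithmic $s$-Carleson measure if there is $C>0$ with $\mu([t,1))\left(\log\frac{1}{1-t}\right)^\alpha\le C(1-t)^s$ for all $0\le t<1$. *)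

(* Defs.v *)
From HB Require Import structures.
From mathcomp Require Import all_boot all_order all_algebra.
From mathcomp Require Import complex.
From mathcomp Require Import all_classical all_reals all_analysis.

Set Implicit Arguments.
Unset Strict Implicit.
Unset Printing Implicit Defensive.

Import Order.TTheory GRing.Theory Num.Theory.
Import numFieldNormedType.Exports.

Local Open Scope classical_set_scope.
Local Open Scope complex_scope.
Local Open Scope ring_scope.

Section Disc.
Variable R : realType.
Local Notation C := R[i]^o.
Implicit Types (f : C -> C) (a : nat -> C) (z : C).

(* A function "on the unit disc" is a total function on R[i]; none of the
   notions below depends on its values outside the open disc.
   R[i]^o is R[i] as a normed module over itself, so [derivable f z 1] is
   complex differentiability at z and [derive1 f] is the complex derivative. *)
Definition analytic_on_disc f : Prop :=
  forall z : C, `|z| < 1 -> derivable f z 1.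

(* Ties f to its Taylor coefficients a at 0, which f determines uniquely and
   which exist for every f analytic on the disc. *)
Definition has_expansion f a : Prop :=
  forall z : C, `|z| < 1 ->
    series (fun k => a k * z ^+ k) @ \oo --> f z.

(* [normc] is the modulus with values in R (whereas [`|z|] lives in R[i]). *)
Definition modulus (z : C) : R := Normc.normc z.

Definition unit_disc : set (measurableTypeR R * measurableTypeR R) :=
  [set w | w.1 ^+ 2 + w.2 ^+ 2 < 1 :> R].

(* Integral over the disc against dA = dx dy / pi. *)
Definition area_integral_disc (g : C -> R) : \bar R :=
  ((pi^-1)%:E *
   \int[(lebesgue_measure \x lebesgue_measure)%E]_(w in unit_disc)
     (g (w.1 +i* w.2)%C)%:E)%E.

Definition besov_density (p : R) f z : R :=
  (1 - modulus z ^+ 2) `^ (p - 2) * modulus (derive1 f z) `^ p.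

Definition besov_seminorm (p : R) f : \bar R :=
  (area_integral_disc (besov_density p f) `^ p^-1%R)%E.

Definition besov (p : R) f : Prop :=
  analytic_on_disc f /\ (besov_seminorm p f < +oo)%E.

Definition besov_norm (p : R) f : \bar R :=
  ((modulus (f 0))%:E + besov_seminorm p f)%E.

End Disc.

Section Hankel.
Variable R : realType.
Local Notation C := R[i]^o.
Variable mu : {measure set (measurableTypeR R) -> \bar R}.
Implicit Types (f : C -> C) (a : nat -> C) (z : C).

(* Finite Borel measures on [0,1) are represented by finite Borel measures on
   the line that vanish off [0,1). *)
Definition concentrated_on_01 : Prop :=
  mu (~` `[0, 1[) = 0%E.

Definition moment (n : nat) : R :=
  \int[mu]_(t in `[0, 1[) (t ^+ n).

Definition hankel_inner a (n : nat) : nat -> C :=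
  series (fun k => (moment (n + k))%:C * a k).

Definition hankel_coef a (n : nat) : C := limn (hankel_inner a n).

Definition hankel a (z : C) : C :=
  limn (series (fun n => hankel_coef a n * z ^+ n)).

(* [limn] is total, so convergence is required separately. *)
Definition hankel_well_defined a : Prop :=
  [/\ forall n, cvgn (hankel_inner a n),
      forall z : C, `|z| < 1 ->
        cvgn (series (fun n => hankel_coef a n * z ^+ n)) &
      analytic_on_disc (hankel a)].

Definition hankel_bounded_on_besov (p : R) : Prop :=
  exists M : R, forall f a, besov p f -> has_expansion f a ->
    [/\ hankel_well_defined a,
        besov p (hankel a) &
        (besov_norm p (hankel a) <= M%:E * besov_norm p f)%E].

Definition log_carleson (alpha s : R) : Prop :=
  exists2 M : R, 0 < M &
    forall t : R, 0 <= t < 1 ->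
      (mu `[t, 1%R[%classic * ((ln (1 - t)^-1) `^ alpha)%:E
       <= (M * (1 - t) `^ s)%:E)%E.

End Hankel.

(* Main.v *)
Require Import Defs.
From mathcomp Require Import all_boot all_order all_algebra.
From mathcomp Require Import complex ring lra.
From mathcomp Require Import all_classical all_reals all_analysis.
From mathcomp Require Import measurable_realfun.
Import Order.TTheory GRing.Theory Num.Theory.
Import numFieldNormedType.Exports.
Set Implicit Arguments.
Unset Strict Implicit.
Unset Printing Implicit Defensive.
Local Open Scope classical_set_scope.
Local Open Scope complex_scope.
Local Open Scope ring_scope.

(** The operator is tested on functions of the Besov space that grow along the
    radius as fast as the space allows, like a normalized logarithm truncated at
    distance 2^-J from the point 1.

    The test function is f(z) = sum of d / (1 + d - z) over d = 2^-1, ..., 2^-J.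
    On [1 - 2^-J, 1) each term is at least 1/2, so f >= J/2 there
    (test_real_ge).  On the other hand |f'(z)| is O(1 / (|1 - z| + 2^-J))
    uniformly in J, by a telescoping estimate (dyadic_sum_le, test_derive_le).
    Integrating the p-th power of this bound against the weight
    (1 - |z|^2)^(p-2) along chords of the disc is elementary: on a chord at
    distance y from the centre the kernel u^(p-2) (u + h)^(-p), with
    h = |y| + 2^-J, has an explicit primitive and integrates to at most
    1 / ((p - 1) h), and the integral of 1 / (|y| + 2^-J) over y is O(J).
    Hence the norm of f is O(J^(1/p)) (test_besov).

    Let g be the image of f.  Formally g(z) is the integral of f(t) / (1 - t z)
    against mu, and g'(z) that of t f(t) / (1 - t z)^2.  When z lies in a
    rectangle of side about 1 - a near a, inside a narrow sector with vertex 1,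
    the real part of 1 / (1 - t z)^2 is positive for every t in [0, 1) and of
    the order of (1 - a)^-2 for t >= a.  As f is nonnegative and increasing on
    [0, 1), no cancellation occurs and |g'(z)| is at least a constant times
    f(a) mu([a, 1)) / (1 - a)^2 (hankel_derive_ge).  The rectangle has area of
    the order of (1 - a)^2 and carries the weight (1 - a)^(p-2), so the seminorm
    of g is at least a constant times f(a) mu([a, 1)) / (1 - a)
    (area_integral_ge).

    Boundedness thus gives J mu([a, 1)) / (1 - a) = O(J^(1/p)) whenever
    1 - a <= 2^-J (carleson_dyadic), and taking J of the order of
    log (1 / (1 - a)) yields the claim. *)


(** * Two comparison tools for integrals *)

(** The integral of a nonnegative function is a supremum over simple functions
    below it, so monotonicity holds for arbitrary functions.  This lets the Besov
    integral of an image under the Hankel operator be bounded below although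
    nothing is known about the measurability of its density. *)
Lemma ge0_le_integral_nomeas d (T : measurableType d) (R : realType)
    (mu : {measure set T -> \bar R}) (D : set T) (f g : T -> \bar R) :
  (forall x, D x -> 0 <= f x)%E -> (forall x, D x -> f x <= g x)%E ->
  (\int[mu]_(x in D) f x <= \int[mu]_(x in D) g x)%E.
Proof.
move=> f0 fg; rewrite !(integral_mkcond D).
have h0 x : (0 <= (f \_ D) x)%E by apply: erestrict_ge0.
have hg x : ((f \_ D) x <= (g \_ D) x)%E by apply: lee_restrict.
rewrite !ge0_integralTE//; last by move=> x; exact: le_trans (hg x).
apply: le_ereal_sup => _ /= [h hf <-]; exists h => // x.
exact: le_trans (hf x) (hg x).
Qed.

(** Only bounded oscillation of the primitive is asked for, and nothing at the
    end points, so this covers improper integrals: the kernels below are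
    unbounded at an end point as soon as p < 2. *)
Lemma ge0_integral_oo_le (R : realType) (F f : R -> R) (a b c : R) : a < b ->
  {in `]a, b[, forall x : R, is_derive x 1 F (f x)} ->
  {in `]a, b[, continuous f} ->
  {in `]a, b[, forall x, 0 <= f x} ->
  {in `]a, b[ &, forall x y, F y - F x <= c} ->
  (\int[lebesgue_measure]_(x in `]a, b[) (f x)%:E <= c%:E)%E.
Proof.
move=> ab dF cf f0 Fc.
(* The intervals [a + e n, b - e n] exhaust ]a, b[; the shift by 3 keeps
   even the first one nondegenerate. *)
pose e n : R := (b - a) / n.+3%:R.
have ba0 : 0 < b - a by rewrite subr_gt0.
have e0 n : 0 < e n by rewrite divr_gt0.
have e3 n : e n < (b - a) / 2 by rewrite ltr_pM2l// ltf_pV2 ?posrE// ltr_nat.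
have sub n : `[a + e n, b - e n] `<=` `]a, b[.
  move=> x /=; rewrite !in_itv/= => /andP[h1 h2]; have := e0 n; lra.
pose S n : set (measurableTypeR R) := `[a + e n, b - e n]%classic.
have Scup : `]a, b[%classic = \bigcup_n S n.
  apply/seteqP; split => [x /=|x [n _] /sub//].
  rewrite in_itv/= => /andP[ax xb].
  pose m := Num.min (x - a) (b - x).
  have m0 : 0 < m by rewrite lt_min !subr_gt0 ax.
  exists (Num.truncn ((b - a) / m)) => //=.
  have hm : e (Num.truncn ((b - a) / m)) <= m.
    rewrite /e ler_pdivrMr// mulrC -ler_pdivrMr//.
    apply: (le_trans (ltW (truncnS_gt _))).
    by rewrite ler_nat ltnS -addn2 leq_addr.
  move: hm; rewrite /m le_min => /andP[h1 h2].
  by rewrite /S/= in_itv/=; lra.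
have ndS : nondecreasing_seq S.
  move=> m n mn; rewrite subsetEset => x; rewrite /S/= !in_itv/= => /andP[h1 h2].
  have : e n <= e m by rewrite ler_pM2l// lef_pV2 ?posrE// ler_nat.
  lra.
have cS n : {within S n, continuous f}.
  apply: continuous_in_subspaceT => x; rewrite inE => /sub; exact: cf.
rewrite Scup.
have := @ge0_nondecreasing_set_cvg_integral _ _ R S (EFin \o f)
  lebesgue_measure ndS.
move=> /(_ _ _ _)/cvg_lim <-//; last 3 first.
- by move=> n; exact: measurable_itv.
- move=> n; apply/measurable_EFinP.
  by apply: subspace_continuous_measurable_fun => //; exact: measurable_itv.
- by move=> n x /sub xS; rewrite lee_fin f0.
apply: lime_le.
  apply: ereal_nondecreasing_is_cvgn.
  apply: ge0_nondecreasing_set_nondecreasing_integral => //.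
  - by move=> n; exact: measurable_itv.
  - move=> n; apply/measurable_EFinP.
    by apply: subspace_continuous_measurable_fun => //; exact: measurable_itv.
  - by move=> n x /sub xS; rewrite lee_fin f0.
apply: nearW => n /=.
have en := e3 n; have en0 := e0 n.
have dcF x : x \in `]a, b[ -> {for x, continuous F}.
  move=> xab; apply: differentiable_continuous; apply/derivable1_diffP.
  by have [] := dF x xab.
have xl : a + e n \in `]a, b[ by apply: sub; rewrite /= in_itv/=; lra.
have xr : b - e n \in `]a, b[ by apply: sub; rewrite /= in_itv/=; lra.
rewrite (@continuous_FTC2 _ f F)//; first by rewrite -EFinB lee_fin Fc.
- lra.
- exact: cS.
- split.
  + move=> x xI; have xab : x \in `]a, b[.
      by apply: (sub n); move: xI; rewrite /= !in_itv/=; lra.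
    by have [] := dF x xab.
  + by apply: cvg_at_right_filter; exact: dcF.
  + by apply: cvg_at_left_filter; exact: dcF.
- move=> x xI; have xab : x \in `]a, b[.
    by apply: (sub n); move: xI; rewrite /= !in_itv/=; lra.
  by rewrite derive1E; have [] := dF x xab.
Qed.


(** * The one-dimensional kernel and its integral *)

Lemma is_derive_affine (R : realType) (a b x : R) :
  is_derive x 1 (fun u : R => a * u + b) a.
Proof.
have h : is_derive x 1 (a \*: (@id R) + cst b : R -> R) (a *: (1 : R) + 0).
  by apply: is_deriveD.
by apply: is_derive_eq h _; rewrite addr0 /GRing.scale /= mulr1.
Qed.

Lemma is_derive_powR_affine (R : realType) (a b q x : R) : 0 < a * x + b ->
  is_derive x 1 (fun u : R => (a * u + b) `^ q) (q * (a * x + b) `^ (q - 1) * a).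
Proof.
move=> h.
have h1 := @is_derive1_powR R q (a * x + b) h.
have h2 := is_derive_affine a b x.
exact (@is_derive1_comp R (fun u : R => u `^ q) (fun u : R => a * u + b) x _ a h1 h2).
Qed.

Section Kernel.
Variable R : realType.
Implicit Types (p h s u x y : R).

(** With u the distance to the boundary of the disc along a chord and h the
    distance of that chord to the point 1, kern p h u is, up to a constant, the
    Besov density of log (1 / (1 - z)): weight u ^ (p - 2) times
    |1 - z| ^ (- p). *)
Definition kern p h u : R := u `^ (p - 2) * (u + h) `^ (- p).

Lemma kern_ge0 p h u : 0 <= kern p h u.
Proof. by rewrite mulr_ge0 ?powR_ge0. Qed.

(** The kernel has the elementary primitive
    (u / (u + h)) ^ (p - 1) / ((p - 1) h) in u.  The sign e, equal to 1 or -1,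
    treats both halves of a chord at once. *)
Lemma is_derive_kern_prim p h e s x : 1 < p -> 0 < h -> 0 < e * x + s ->
  e ^+ 2 = 1 ->
  is_derive x 1 (fun x : R => e * (e * x + s) `^ (p - 1) *
    (e * x + (s + h)) `^ (1 - p) / ((p - 1) * h)) (kern p h (e * x + s)).
Proof.
move=> p1 h0 u0 e2.
have uh0 : 0 < e * x + (s + h) by rewrite addrA addr_gt0.
have dFG := is_deriveM (is_derive_powR_affine (p - 1) u0)
  (is_derive_powR_affine (1 - p) uh0).
have /is_derive_eq := is_deriveZ (e / ((p - 1) * h)) dFG.
move=> /(_ (kern p h (e * x + s))) d; rewrite (_ : (fun _ => _) = (e / ((p - 1) * h)) \*:
  ((fun u : R => (e * u + s) `^ (p - 1)) * (fun u : R => (e * u + (s + h)) `^ (1 - p)))).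
  apply: d.
  have -> : p - 1 - 1 = p - 2 by ring.
  have -> : 1 - p - 1 = - p by ring.
  rewrite /kern /GRing.scale/= addrA.
  set u := e * x + s in u0 uh0 *.
  have uh1 : 0 < u + h by rewrite /u -addrA.
  have -> : u `^ (p - 1) = u * u `^ (p - 2).
    have -> : p - 2 = p - 1 - 1 by ring.
    by rewrite mulr_powRB1 ?(ltW u0)//; lra.
  have -> : (u + h) `^ (1 - p) = (u + h) * (u + h) `^ (- p).
    rewrite powRD; last by rewrite (gt_eqF uh1)/= implybT.
    by rewrite powRr1 // ltW.
  have p10 : p - 1 != 0 by rewrite subr_eq0 gt_eqF.
  have hn0 : h != 0 by rewrite gt_eqF.
  transitivity (e ^+ 2 * (u `^ (p - 2) * (u + h) `^ (- p))); last by rewrite e2 mul1r.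
  by field; apply/andP.
apply/funext => u /=; rewrite /GRing.scale/=.
set c := ((p - 1) * h)^-1; rewrite [RHS]mulrA; ring.
Qed.

Lemma continuous_kern p h e s x : 0 < h -> 0 < e * x + s ->
  {for x, continuous (fun x : R => kern p h (e * x + s))}.
Proof.
move=> h0 u0.
have uh0 : 0 < e * x + (s + h) by rewrite addrA addr_gt0.
have [d _] := is_deriveM (is_derive_powR_affine (p - 2) u0)
  (is_derive_powR_affine (- p) uh0).
rewrite (_ : (fun x => kern p h (e * x + s)) =
    ((fun x : R => (e * x + s) `^ (p - 2)) * (fun x : R => (e * x + (s + h)) `^ (- p)))).
  by apply: differentiable_continuous; apply/derivable1_diffP.
by apply/funext => y; rewrite /kern -addrA.
Qed.

(** The primitive of the kernel takes values between 0 and 1 / ((p - 1) h),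
    whatever the length of the chord; p > 1 is what makes the singularity
    u ^ (p - 2) integrable. *)
Lemma kern_integral_le p h e s : 1 < p -> 0 < h -> 0 < s -> e = 1 \/ e = -1 ->
  (\int[lebesgue_measure]_(x in `](- s)%R, s[) (kern p h (e * x + s))%:E <=
   (((p - 1) * h)^-1)%:E)%E.
Proof.
move=> p1 h0 s0 e1.
have pos x : x \in `](- s), s[ -> 0 < e * x + s.
  by rewrite in_itv/=; case: e1 => ->; lra.
have e2 : e ^+ 2 = 1 by case: e1 => ->; rewrite ?expr1n ?sqrrN ?expr1n.
apply: (@ge0_integral_oo_le R (fun x : R => e * (e * x + s) `^ (p - 1) *
    (e * x + (s + h)) `^ (1 - p) / ((p - 1) * h))).
- lra.
- by move=> x /pos u0; exact: is_derive_kern_prim.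
- by move=> x /pos u0; exact: continuous_kern.
- by move=> x _; exact: kern_ge0.
move=> x y xs ys.
pose Phi u : R := u `^ (p - 1) * (u + h) `^ (1 - p).
have Phi0 u : 0 <= Phi u by rewrite mulr_ge0 ?powR_ge0.
have Phi1 u : 0 < u -> Phi u <= 1.
  move=> u0; rewrite /Phi -(opprB p 1) powRN ler_pdivrMr ?mul1r; last first.
    by rewrite powR_gt0 ?addr_gt0.
  apply: ge0_ler_powR; rewrite ?nnegrE ?subr_ge0; lra.
rewrite -mulrBl ler_piMl//.
  by rewrite invr_ge0 mulr_ge0 ?(ltW h0)// subr_ge0 ltW.
rewrite -!mulrA !addrA -!/(Phi _).
have := Phi1 _ (pos _ xs); have := Phi1 _ (pos _ ys).
have := Phi0 (e * x + s); have := Phi0 (e * y + s).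
by case: e1 => ->; lra.
Qed.

(** This integral is where the logarithm comes from: it stays of the order of
    ln (1 / d), the number of dyadic scales between d and 1. *)
Lemma integral_inv_abs_le (d : R) : 0 < d ->
  (\int[lebesgue_measure]_(y in `](-1)%R, 1%R[) ((`|y| + d)^-1)%:E <=
   (2 * ln ((1 + d) / d))%:E)%E.
Proof.
move=> d0.
(* Both halves of ]-1, 1[ at once: e * y is |y| there. *)
have key (e : R) (a b : R) : e = 1 \/ e = -1 -> a < b ->
   (forall x, x \in `]a, b[ -> 0 <= e * x < 1) ->
  (\int[lebesgue_measure]_(y in `]a, b[) ((e * y + d)^-1)%:E <=
   (ln ((1 + d) / d))%:E)%E.
  move=> e1 ab ex.
  have e2 : e * e = 1 by case: e1 => ->; rewrite ?mulrNN mulr1.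
  have pos x : x \in `]a, b[ -> 0 < e * x + d.
    by move=> /ex /andP[? _]; rewrite ltr_wpDl.
  apply: (@ge0_integral_oo_le R (fun x : R => e * ln (e * x + d))) => //.
  - move=> x /pos u0.
    have h1 := @is_derive1_ln R _ u0.
    have h2 := is_derive_affine e d x.
    have h3 := @is_derive1_comp R (@ln R) (fun u : R => e * u + d) x _ e h1 h2.
    have h4 := is_deriveZ e h3.
    apply: is_derive_eq h4 _.
    by rewrite /GRing.scale/= mulrCA e2 mulr1.
  - move=> x /pos u0.
    apply: cvgV; first by rewrite gt_eqF.
    have [dd _] := is_derive_affine e d x.
    suff: {for x, continuous (fun y : R => e * y + d)} by [].
    by apply: differentiable_continuous; apply/derivable1_diffP.
  - by move=> x /pos u0; rewrite invr_ge0 ltW.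
  move=> x y xs ys.
  have lb u : 0 <= u < 1 -> ln d <= ln (u + d) <= ln (1 + d).
    by move=> /andP[u0 u1]; rewrite !ler_ln ?posrE; lra.
  have := lb _ (ex _ xs); have := lb _ (ex _ ys).
  rewrite ln_div ?posrE//; last by rewrite addr_gt0.
  by case: e1 => ->; lra.
have mf (A : set R) : measurable_fun A (fun y : R => ((`|y| + d)^-1)%:E).
  apply/measurable_EFinP.
  have -> : (fun y : R => (`|y| + d)^-1) = (fun y : R => (`|y| + d) `^ (-1)).
    by apply/funext => y; rewrite powR_inv1// addr_ge0// ltW.
  apply: (@measurableT_comp _ _ _ _ _ _ (fun u : R => u `^ (-1))).
    exact: measurable_powR.
  by apply: measurable_funD => //; exact: normr_measurable.
have -> : `](-1)%R, 1%R[%classic = `](-1)%R, 0%R[%classic `|` `[0%R, 1%R[%classic :> set R.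
  by rewrite -itv_bndbnd_setU // bnd_simp.
rewrite ge0_integral_setU //; last 3 first.
- exact: mf.
- by move=> y _; rewrite lee_fin invr_ge0 addr_ge0// ltW.
- apply/disj_setPS => y [] /=; rewrite !in_itv/=; lra.
rewrite -integral_itv_obnd_cbnd; last exact: mf.
have h0 (y : R) : (0 <= ((`|y| + d)^-1)%:E)%E.
  by rewrite lee_fin invr_ge0 addr_ge0// ltW.
rewrite mulrDl mul1r EFinD; apply: leeD.
- apply: (@le_trans _ _ (\int[lebesgue_measure]_(y in `](-1)%R, 0%R[) ((-1 * y + d)^-1)%:E)%E).
    apply: ge0_le_integral_nomeas => // y; rewrite /= in_itv /= => /andP[_ y0].
    by rewrite ltr0_norm// mulN1r.
  apply: key; [by right|by []|].
  by move=> x; rewrite in_itv/=; lra.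
- apply: (@le_trans _ _ (\int[lebesgue_measure]_(y in `]0%R, 1%R[) ((1 * y + d)^-1)%:E)%E).
    apply: ge0_le_integral_nomeas => // y; rewrite /= in_itv /= => /andP[y0 _].
    by rewrite gtr0_norm// mul1r.
  apply: key; [by left|by []|].
  by move=> x; rewrite in_itv/=; lra.
Qed.

End Kernel.


(** * The kernel integrated over the disc *)

Section DiscKernel.
Variable R : realType.
Implicit Types (p d s u x y : R).
Local Notation T := (measurableTypeR R).

(** The two summands belong to the two end points of the horizontal chord at
    height y.  On the disc their sum dominates the term of the nearer end point,
    whose distance is sqrt (1 - y ^ 2) - |x|, without any absolute value of the
    variable x that is integrated first. *)
Definition disc_kern p d x y : R :=
  kern p (`|y| + d) (Num.sqrt (1 - y ^+ 2) + x) +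
  kern p (`|y| + d) (Num.sqrt (1 - y ^+ 2) - x).

Lemma disc_kern_ge0 p d x y : 0 <= disc_kern p d x y.
Proof. by rewrite addr_ge0 ?kern_ge0. Qed.

Lemma disc_slice x y : x ^+ 2 + y ^+ 2 < 1 ->
  - Num.sqrt (1 - y ^+ 2) < x < Num.sqrt (1 - y ^+ 2).
Proof.
move=> xy; have x2 := sqr_ge0 x; rewrite -ltr_norml -sqrtr_sqr ltr_sqrt; lra.
Qed.

Lemma measurable_kern disp (U : measurableType disp) p (h u : U -> R) :
  measurable_fun setT h -> measurable_fun setT u ->
  measurable_fun setT (fun z => kern p (h z) (u z)).
Proof.
move=> mh mu; apply: measurable_funM.
  by apply: (measurableT_comp (measurable_powR _)).
apply: (measurableT_comp (measurable_powR _)).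
exact: measurable_funD.
Qed.

Lemma measurable_disc_kern p d (a b : T * T -> R) :
  measurable_fun setT a -> measurable_fun setT b ->
  measurable_fun setT (fun w => disc_kern p d (a w) (b w)).
Proof.
move=> ma mb.
have ms : measurable_fun setT (fun w => Num.sqrt (1 - b w ^+ 2)).
  apply: (measurableT_comp (continuous_measurable_fun (@sqrt_continuous R))).
  by apply: measurable_funB => //; exact: measurable_funX.
have mh : measurable_fun setT (fun w => `|b w| + d).
  by apply: measurable_funD => //; exact: (measurableT_comp (@normr_measurable R _)).
apply: measurable_funD; apply: measurable_kern => //.
- exact: measurable_funD.
- exact: measurable_funB.
Qed.

Lemma measurable_unit_disc : measurable (@unit_disc R).
Proof.
have mf : measurable_fun setT (fun w : T * T => w.1 ^+ 2 + w.2 ^+ 2).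
  by apply: measurable_funD; apply: measurable_funX.
have := mf measurableT _ (measurable_itv `]-oo, 1[).
by rewrite setTI.
Qed.

(** The kernel on the chord at height y integrates to a multiple of
    1 / (|y| + d); chords with |y| >= 1 miss the disc. *)
Lemma disc_kern_slice_le p d y : 1 < p -> 0 < d ->
  (\int[lebesgue_measure]_x
     ((if x ^+ 2 + y ^+ 2 < 1 :> R then disc_kern p d x y else 0)%:E) <=
   ((fun y => (2 / (p - 1) * (`|y| + d)^-1)%:E) \_ `](-1)%R, 1%R[) y)%E.
Proof.
move=> p1 d0.
rewrite patchE; case: ifPn => [|]; rewrite ?inE /= ?in_itv /= => hy; last first.
  rewrite le_eqVlt; apply/orP; left; apply/eqP.
  apply: integral0_eq => x _; case: ifPn => // xy.
  exfalso; move/negP: hy; apply.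
have : y ^+ 2 < 1 by have := sqr_ge0 x; lra.
  rewrite inE/= in_itv/= => h; apply/andP; split; nra.
have y2 : 0 < 1 - y ^+ 2 by nra.
set s := Num.sqrt (1 - y ^+ 2).
have s0 : 0 < s by rewrite sqrtr_gt0.
have h0 : 0 < `|y| + d by rewrite ltr_wpDl.
apply: (@le_trans _ _ (\int[lebesgue_measure]_(x in `](- s)%R, s[)
   ((kern p (`|y| + d) (1 * x + s))%:E + (kern p (`|y| + d) (-1 * x + s))%:E))%E).
  rewrite [leRHS]integral_mkcond.
  apply: ge0_le_integral_nomeas => x _.
    by case: ifPn => // _; rewrite lee_fin disc_kern_ge0.
  rewrite patchE; case: ifPn => xy; last first.
    by case: ifPn => // _; rewrite adde_ge0// lee_fin kern_ge0.
  have := disc_slice xy; rewrite -/s => xs.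
  rewrite ifT; last by rewrite inE /= in_itv.
  by rewrite lee_fin /disc_kern -/s mul1r mulN1r (addrC x) (addrC (- x)).
have mk (e : R) : measurable_fun `](- s), s[ (fun x : R => (kern p (`|y| + d) (e * x + s))%:E).
  apply/measurable_EFinP; apply: measurable_funTS.
  apply: measurable_kern => //.
  by apply: measurable_funD => //; exact: measurable_funM.
rewrite ge0_integralD //; try exact: mk;
  try by move=> x _; rewrite lee_fin kern_ge0.
apply: (@le_trans _ _ (((p - 1) * (`|y| + d))^-1%:E + ((p - 1) * (`|y| + d))^-1%:E)%E).
  by apply: leeD; apply: kern_integral_le => //; [left|right].
by rewrite -EFinD lee_fin invfM; lra.
Qed.

Lemma slice_bound_integral_le p d : 1 < p -> 0 < d ->
  (\int[lebesgue_measure]_y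
    ((fun y => (2 / (p - 1) * (`|y| + d)^-1)%:E) \_ `](-1)%R, 1%R[) y <=
   (4 / (p - 1) * ln ((1 + d) / d))%:E)%E.
Proof.
move=> p1 d0; rewrite -integral_mkcond.
under eq_integral do rewrite EFinM.
have c0 : 0 <= 2 / (p - 1) by rewrite divr_ge0// subr_ge0 ltW.
rewrite ge0_integralZl_EFin//; last 2 first.
- by move=> y _; rewrite lee_fin invr_ge0 addr_ge0// ltW.
- apply/measurable_EFinP; apply: measurable_funTS.
  have -> : (fun y : R => (`|y| + d)^-1) = (fun y : R => (`|y| + d) `^ (-1)).
    by apply/funext => y; rewrite powR_inv1// addr_ge0// ltW.
  apply: (measurableT_comp (measurable_powR _)).
  by apply: measurable_funD => //; exact: normr_measurable.
apply: (@le_trans _ _ ((2 / (p - 1))%:E * (2 * ln ((1 + d) / d))%:E)%E).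
  by apply: lee_wpmul2l; rewrite ?lee_fin//; exact: integral_inv_abs_le.
by rewrite -EFinM lee_fin; lra.
Qed.

Lemma disc_kern_integral_le p d : 1 < p -> 0 < d ->
  (\int[lebesgue_measure \x lebesgue_measure]_(w in @unit_disc R)
     (disc_kern p d w.1 w.2)%:E <= (4 / (p - 1) * ln ((1 + d) / d))%:E)%E.
Proof.
move=> p1 d0; rewrite integral_mkcond fubini_tonelli2/=; last 2 first.
- apply/(measurable_restrictT _ _).1; first exact: measurable_unit_disc.
  by apply: measurable_funTS; apply/measurable_EFinP; exact: measurable_disc_kern.
- by move=> w; apply: erestrict_ge0 => z _; rewrite lee_fin disc_kern_ge0.
apply: le_trans (slice_bound_integral_le p1 d0).
apply: ge0_le_integral_nomeas => y _.
  apply: integral_ge0 => x _.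
  by apply: erestrict_ge0 => z _; rewrite lee_fin disc_kern_ge0.
apply: le_trans (disc_kern_slice_le y p1 d0); rewrite /fubini_G.
apply: ge0_le_integral_nomeas => x _.
  by apply: erestrict_ge0 => z _; rewrite lee_fin disc_kern_ge0.
rewrite patchE; case: ifPn; rewrite ?inE/unit_disc/= => xy; first by rewrite xy.
by case: ifPn => // _; rewrite lee_fin disc_kern_ge0.
Qed.

(** The same bound with the coordinates exchanged follows by integrating in the
    other order; it serves the part of the disc where |x| < |y|, on which
    horizontal chords may be too short. *)
Lemma disc_kern_swap_integral_le p d : 1 < p -> 0 < d ->
  (\int[lebesgue_measure \x lebesgue_measure]_(w in @unit_disc R)
     (disc_kern p d w.2 w.1)%:E <= (4 / (p - 1) * ln ((1 + d) / d))%:E)%E.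
Proof.
move=> p1 d0; rewrite integral_mkcond fubini_tonelli1/=; last 2 first.
- apply/(measurable_restrictT _ _).1; first exact: measurable_unit_disc.
  by apply: measurable_funTS; apply/measurable_EFinP; exact: measurable_disc_kern.
- by move=> w; apply: erestrict_ge0 => z _; rewrite lee_fin disc_kern_ge0.
apply: le_trans (slice_bound_integral_le p1 d0).
apply: ge0_le_integral_nomeas => y _.
  apply: integral_ge0 => x _.
  by apply: erestrict_ge0 => z _; rewrite lee_fin disc_kern_ge0.
apply: le_trans (disc_kern_slice_le y p1 d0); rewrite /fubini_F.
apply: ge0_le_integral_nomeas => x _.
  by apply: erestrict_ge0 => z _; rewrite lee_fin disc_kern_ge0.
rewrite patchE; case: ifPn; rewrite ?inE/unit_disc/= => xy.
  by rewrite addrC xy.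
by case: ifPn => // _; rewrite lee_fin disc_kern_ge0.
Qed.

End DiscKernel.


(** * Moduli and limits of complex sequences *)

Section ComplexBasics.
Variable R : realType.
Local Notation C := R[i]^o.
Local Notation Re := (@complex.Re R).
Local Notation Im := (@complex.Im R).
Implicit Types (z w : C).

Lemma normE z : `|z| = (modulus z)%:C.
Proof. by []. Qed.

Lemma modulusE z : modulus z = Num.sqrt (Re z ^+ 2 + Im z ^+ 2).
Proof. by case: z. Qed.

Lemma modulus_ge0 z : 0 <= modulus z.
Proof. by rewrite modulusE sqrtr_ge0. Qed.

Lemma modulus_sqr z : modulus z ^+ 2 = Re z ^+ 2 + Im z ^+ 2.
Proof. by rewrite modulusE sqr_sqrtr// addr_ge0 ?sqr_ge0. Qed.

Lemma norm_lt1 z : (`|z| < 1) = (modulus z < 1).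
Proof. by rewrite normE -[1]/((1 : R)%:C) ltcR. Qed.

Lemma modulus_lt1 z : (modulus z < 1) = (Re z ^+ 2 + Im z ^+ 2 < 1).
Proof. by rewrite -modulus_sqr expr_lt1// modulus_ge0. Qed.

Lemma Re_le_modulus z : `|Re z| <= modulus z.
Proof.
by rewrite modulusE -sqrtr_sqr ler_wsqrtr// lerDl sqr_ge0.
Qed.

Lemma Im_le_modulus z : `|Im z| <= modulus z.
Proof.
by rewrite modulusE -sqrtr_sqr ler_wsqrtr// lerDr sqr_ge0.
Qed.

(** Convergence in R[i] is measured by a norm with values in R[i]; this
    equivalence brings it back to a limit of real numbers. *)
Lemma cvg_modulusP (u : nat -> C) (l : C) :
  (u @ \oo --> l) <-> ((fun n => modulus (l - u n)) @ \oo --> (0 : R)).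
Proof.
split => [/cvgrPdist_lt h|/cvgrPdist_lt h]; apply/cvgrPdist_lt => e e0.
  have : 0 < e%:C by rewrite -[0]/((0 : R)%:C) ltcR.
  move=> /h; apply: filterS => n.
  by rewrite normE ltcR sub0r normrN ger0_norm// modulus_ge0.
have er : e = (Re e)%:C.
  by move: e0; rewrite ltcE /=; case: e => a b /= /andP[/eqP -> _].
rewrite er in e0 *.
move: e0; rewrite -[0]/((0 : R)%:C) ltcR => /h; apply: filterS => n.
by rewrite normE ltcR sub0r normrN ger0_norm// modulus_ge0.
Qed.

Lemma cvg_Re (u : nat -> C) (l : C) :
  u @ \oo --> l -> (fun n => Re (u n)) @ \oo --> Re l.
Proof.
move=> /cvg_modulusP/cvgrPdist_lt h; apply/cvgrPdist_lt => e /h.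
apply: filterS => n; rewrite sub0r normrN ger0_norm ?modulus_ge0//.
apply: le_lt_trans; apply: le_trans (Re_le_modulus _).
by rewrite raddfB.
Qed.

Lemma cvg_real_complex (u : nat -> R) (l : R) :
  u @ \oo --> l -> (fun n => (u n)%:C : C) @ \oo --> (l%:C : C).
Proof.
move=> ul; apply/cvg_modulusP.
have -> : (fun n => modulus ((l%:C : C) - (u n)%:C)) = (fun n => `|l - u n|).
  apply/funext => n; rewrite modulusE /= subr0 expr0n/= addr0 sqrtr_sqr.
  by [].
have : (fun n => l - u n) @ \oo --> l - l by apply: cvgB => //; exact: cvg_cst.
by rewrite subrr => /cvg_norm; rewrite normr0.
Qed.

Lemma modulusM z w : modulus (z * w) = modulus z * modulus w.
Proof. exact: Normc.normcM. Qed.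

Lemma modulusV z : modulus (z^-1) = (modulus z)^-1.
Proof. exact: Normc.normcV. Qed.

Lemma modulusX z n : modulus (z ^+ n) = modulus z ^+ n.
Proof.
elim: n => [|n IH]; first by rewrite !expr0 modulusE/= expr0n/= addr0 expr1n sqrtr1.
by rewrite !exprS modulusM IH.
Qed.

Lemma modulus_real (x : R) : modulus x%:C = `|x|.
Proof. by rewrite modulusE/= expr0n/= addr0 sqrtr_sqr. Qed.

Lemma modulus_geometric_tail z n : modulus z < 1 ->
  modulus ((1 - z)^-1 - \sum_(k < n) z ^+ k) <= modulus z ^+ n / (1 - modulus z).
Proof.
move=> z1.
have z10 : 1 - z != 0.
  rewrite subr_eq0; apply: contraTN z1 => /eqP <-.
  by rewrite modulusE/= expr0n/= addr0 expr1n sqrtr1 ltxx.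
have -> : (1 - z)^-1 - \sum_(k < n) z ^+ k = z ^+ n / (1 - z).
  apply: (mulfI z10); rewrite mulrBr mulfV// mulrCA mulfV// mulr1.
  by rewrite -[RHS](subrK 1) subrX1; ring.
rewrite modulusM modulusX modulusV ler_wpM2l ?exprn_ge0 ?modulus_ge0//.
have h1 : 1 - modulus z <= modulus (1 - z).
  rewrite lerBlDr; apply: (@le_trans _ _ (modulus (1 - z + z))).
    by rewrite subrK -[X in modulus X]/((1 : R)%:C) modulus_real normr1.
  exact: le_normcD.
by rewrite lef_pV2 ?posrE ?subr_gt0//; apply: lt_le_trans h1; rewrite subr_gt0.
Qed.

Lemma cvg_geometric_complex z : modulus z < 1 ->
  series (fun k => z ^+ k) @ \oo --> ((1 - z)^-1 : C).
Proof.
move=> z1; apply/cvg_modulusP.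
have z0 := modulus_ge0 z.
have h : (fun n => modulus z ^+ n / (1 - modulus z)) @ \oo --> (0 : R).
  rewrite -(mul0r (1 - modulus z)^-1); apply: cvgM; last exact: cvg_cst.
  by apply: cvg_expr; rewrite ger0_norm.
apply: squeeze_cvgr h; last exact: cvg_cst.
apply: nearW => n; rewrite modulus_ge0/= /series/= big_mkord.
exact: modulus_geometric_tail.
Qed.


End ComplexBasics.


(** * The test functions *)

Section TestFunction.
Variable R : realType.
Local Notation C := R[i]^o.
Local Notation Re := (@complex.Re R).
Local Notation Im := (@complex.Im R).
Implicit Types (z w : C) (t r : R) (J : nat).

Definition dyad j : R := 2^-1 ^+ j.

Lemma dyad_gt0 j : 0 < dyad j.
Proof. by rewrite exprn_gt0// invr_gt0. Qed.

Lemma dyadS j : dyad j = 2 * dyad j.+1.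
Proof. by rewrite /dyad exprS mulrA mulfV ?mul1r. Qed.

Lemma dyad_le i j : (i <= j)%N -> dyad j <= dyad i.
Proof. by move=> ij; rewrite /dyad ler_wiXn2l// ?invr_ge0// invf_le1 ?ler1n. Qed.

Lemma dyad_le1 j : dyad j <= 1.
Proof. by have := dyad_le (leq0n j); rewrite {2}/dyad expr0. Qed.

(** Up to a bounded term, log (1 / (1 - z)) is the integral of e / (1 + e - z)
    against de / e for e between 0 and 1; this is its dyadic discretization,
    truncated at distance dyad J from the point 1.  The terms are rational, so
    derivative and Taylor coefficients are explicit. *)
Definition test_fun J (z : C) : C :=
  \sum_(j < J) (dyad j.+1)%:C * (1 + (dyad j.+1)%:C - z)^-1.

Definition test_coef J k : R := \sum_(j < J) dyad j.+1 / (1 + dyad j.+1) ^+ k.+1.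

Definition test_real J t : R := \sum_(j < J) dyad j.+1 / (1 + dyad j.+1 - t).

Definition test_derive J (z : C) : C :=
  \sum_(j < J) (dyad j.+1)%:C * (1 + (dyad j.+1)%:C - z) ^- 2.

(** The modulus dominates the real and the imaginary part, hence their mean, and
    the real part 1 + d - Re z is positive on the disc. *)
Lemma test_denom_modulus (d : R) z : 0 < d -> modulus z < 1 ->
  d + (1 - Re z) + `|Im z| <= 2 * modulus (1 + d%:C - z).
Proof.
move=> d0 z1.
have hr := Re_le_modulus z.
have h1 := Re_le_modulus (1 + d%:C - z).
have h2 := Im_le_modulus (1 + d%:C - z).
have eR : Re (1 + d%:C - z) = 1 + d - Re z by case: (z) => a b.
have eI : Im (1 + d%:C - z) = - Im z by case: (z) => a b /=; rewrite addr0 add0r.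
rewrite eR in h1; rewrite eI normrN in h2.
have : Re z < 1 by move: hr; rewrite ler_norml => /andP[_]; lra.
move: h1; rewrite ler_norml => /andP[_]; lra.
Qed.

Lemma test_denom_neq0 (d : R) z : 0 < d -> modulus z < 1 -> 1 + d%:C - z != 0.
Proof.
move=> d0 z1; have := test_denom_modulus d0 z1.
apply: contraTneq => ->; rewrite modulusE/= !expr0n/= addr0 sqrtr0 mulr0 -ltNge.
have := Re_le_modulus z; rewrite ler_norml => /andP[_].
have := normr_ge0 (Im z); lra.
Qed.

Lemma is_derive_test_fun J z : modulus z < 1 ->
  is_derive z 1 (test_fun J) (test_derive J z).
Proof.
move=> z1.
have -> : test_fun J = \sum_(j < J)
    (fun z : C => (dyad j.+1)%:C * (1 + (dyad j.+1)%:C - z)^-1).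
  by apply/funext => w; rewrite fct_sumE.
apply: is_derive_sum => j.
set d := dyad j.+1; have d0 : 0 < d by exact: dyad_gt0.
have nz := test_denom_neq0 d0 z1.
have h1 : is_derive z 1 (cst (1 + d%:C) - id : C -> C) (0 - 1) by apply: is_deriveB.
have [dh vh] := h1.
have h2 : is_derive z 1 (fun w : C => ((cst (1 + d%:C) - id : C -> C) w)^-1)
   (- (1 + d%:C - z) ^- 2 *: (0 - 1)).
  apply: DeriveDef; first exact: derivableV.
  by rewrite deriveV// vh.
have h3 := is_deriveZ (d%:C : C) h2.
apply: is_derive_eq h3 _.
by rewrite /GRing.scale/= sub0r mulrN1 opprK.
Qed.

Lemma has_expansion_test_fun J :
  has_expansion (test_fun J) (fun k => (test_coef J k)%:C).
Proof.
move=> z; rewrite norm_lt1 => z1.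
rewrite /test_fun /test_coef.
elim: J => [|J IH].
  rewrite big_ord0 (_ : series _ = cst 0); first exact: cvg_cst.
  by apply/funext => n; rewrite /series/= big1// => k _; rewrite big_ord0 mul0r.
rewrite big_ord_recr/=.
set d := dyad J.+1; have d0 : 0 < d by exact: dyad_gt0.
have d1 : 0 < 1 + d by rewrite addr_gt0.
pose q : C := z / (1 + d%:C).
have nz := test_denom_neq0 d0 z1.
have e1 : 1 + d%:C = (1 + d)%:C :> C by rewrite rmorphD rmorph1.
have nd : 1 + d%:C != 0 :> C.
  by rewrite e1 -[0]/((0:R)%:C) (inj_eq (@complexI R)) gt_eqF.
have q1 : modulus q < 1.
  rewrite /q modulusM modulusV e1 modulus_real gtr0_norm// ltr_pdivrMr// mul1r.
  by apply: lt_trans z1 _; rewrite ltrDl.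
have c1 := cvg_geometric_complex q1.
have c2 := cvgD IH (cvgM (cvg_cst (d%:C / (1 + d%:C) : C)) c1).
have -> : d%:C / (1 + d%:C - z) = d%:C / (1 + d%:C) * (1 - q)^-1.
  rewrite -mulrA -invfM; congr (_ * _^-1).
  by rewrite mulrBr mulr1 /q mulrCA mulfV// mulr1.
set v := series _; rewrite (_ : v = series
    (fun k => (\sum_(j < J) dyad j.+1 / (1 + dyad j.+1) ^+ k.+1)%:C * z ^+ k) +
    cst (d%:C / (1 + d%:C) : C) * series (fun k => q ^+ k)); first exact: c2.
apply/funext => n; rewrite {}/v.
rewrite !fctE /series /= mulr_sumr -big_split/=; apply: eq_bigr => k _.
rewrite big_ord_recr/= rmorphD mulrDl; congr (_ + _).
have e2 : (d / (1 + d) ^+ k.+1)%:C = d%:C * (1 + d%:C) ^- k.+1 :> C.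
  by rewrite e1 -rmorphXn -fmorphV -rmorphM.
rewrite -/d -[LHS]/((d / (1 + d) ^+ k.+1)%:C * z ^+ k) e2 /q expr_div_n exprS invfM.
by rewrite !mulrA mulrAC.
Qed.

Lemma test_fun_real J t : test_fun J t%:C = (test_real J t)%:C.
Proof.
rewrite /test_fun /test_real rmorph_sum/=; apply: eq_bigr => j _.
by rewrite rmorphM/= fmorphV rmorphB rmorphD rmorph1.
Qed.

Lemma test_real_mono J t r : t <= r -> r <= 1 -> test_real J t <= test_real J r.
Proof.
move=> tr r1; apply: ler_sum => j _; have d0 := dyad_gt0 j.+1.
rewrite ler_pM2l// lef_pV2 ?posrE; lra.
Qed.

Lemma test_real_ge0 J t : t <= 1 -> 0 <= test_real J t.
Proof.
move=> t1; apply: sumr_ge0 => j _; have d0 := dyad_gt0 j.+1.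
rewrite divr_ge0; lra.
Qed.

Lemma test_real0_le1 J : test_real J 0 <= 1.
Proof.
apply: (@le_trans _ _ (1 - dyad J)); last by rewrite lerBlDr lerDl ltW// dyad_gt0.
rewrite /test_real; elim: J => [|J IH].
  by rewrite big_ord0 /dyad expr0 subrr.
rewrite big_ord_recr/= subr0; have d0 := dyad_gt0 J.+1; have := dyadS J.
have : dyad J.+1 / (1 + dyad J.+1) <= dyad J.+1.
  by rewrite ler_pdivrMr ?addr_gt0// ler_pMr// lerDl ltW.
lra.
Qed.

(** Each of the J summands d / (d + (1 - t)) has d >= dyad J >= 1 - t, so it is
    at least 1 / 2. *)
Lemma test_real_ge J t : t < 1 -> 1 - t <= dyad J -> J%:R / 2 <= test_real J t.
Proof.
move=> t1 tJ.
have -> : J%:R / 2 = \sum_(j < J) (2^-1 : R).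
  by rewrite sumr_const card_ord mulr_natl.
apply: ler_sum => j _; have d0 := dyad_gt0 j.+1.
have := dyad_le (ltn_ord j) => dj.
by rewrite ler_pdivlMr; lra.
Qed.

(** The partial sums of the Taylor series converge uniformly on [0, 1], because
    every pole 1 + dyad j lies at distance at least dyad J beyond 1. *)
Lemma test_real_partial J t n : 0 <= t <= 1 ->
  test_real J t - J%:R * (1 + dyad J) ^- n <=
    \sum_(k < n) test_coef J k * t ^+ k <= test_real J t.
Proof.
move=> /andP[t0 t1].
have -> : J%:R * (1 + dyad J) ^- n = \sum_(j < J) (1 + dyad J) ^- n.
  by rewrite sumr_const card_ord mulr_natl.
have -> : \sum_(k < n) test_coef J k * t ^+ k =
    \sum_(j < J) \sum_(k < n) dyad j.+1 / (1 + dyad j.+1) ^+ k.+1 * t ^+ k.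
  by rewrite exchange_big/=; apply: eq_bigr => k _; rewrite mulr_suml.
have key (j : 'I_J) : let d := dyad j.+1 in
    d / (1 + d - t) - (1 + dyad J) ^- n <=
    \sum_(k < n) d / (1 + d) ^+ k.+1 * t ^+ k <= d / (1 + d - t).
  move=> d; have d0 : 0 < d by exact: dyad_gt0.
  have dJ : dyad J <= d by exact: dyad_le.
  have J0 := dyad_gt0 J.
  have d1 : 1 + d != 0 by rewrite gt_eqF// addr_gt0.
  have dt : 1 + d - t != 0 by rewrite gt_eqF//; lra.
  have -> : \sum_(k < n) d / (1 + d) ^+ k.+1 * t ^+ k =
      d / (1 + d - t) - d / (1 + d - t) * (t / (1 + d)) ^+ n.
    pose q := t / (1 + d).
    have -> : \sum_(k < n) d / (1 + d) ^+ k.+1 * t ^+ k = d / (1 + d) * \sum_(k < n) q ^+ k.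
      rewrite mulr_sumr; apply: eq_bigr => k _.
      by rewrite /q expr_div_n exprS invfM !mulrA mulrAC.
    have -> : \sum_(k < n) q ^+ k = (1 - q ^+ n) / (1 - q).
      have q1 : 1 - q != 0.
        rewrite gt_eqF// subr_gt0 /q ltr_pdivrMr; lra.
      apply: (mulIf q1); rewrite mulfVK//.
      by rewrite -[X in _ = 1 - X](subrK 1) subrX1; ring.
    have -> : (1 - q ^+ n) / (1 - q) = (1 - q ^+ n) * ((1 + d) / (1 + d - t)).
      by congr (_ * _); rewrite /q; field; rewrite d1 dt.
    rewrite -/q; field; by rewrite d1 dt.
  set x := d / (1 + d - t).
  have x1 : x <= 1 by rewrite /x ler_pdivrMr; lra.
  have x0 : 0 <= x by rewrite /x divr_ge0; lra.
  have y0 : 0 <= (t / (1 + d)) ^+ n by rewrite exprn_ge0// divr_ge0; lra.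
  have y1 : (t / (1 + d)) ^+ n <= (1 + dyad J) ^- n.
    rewrite -exprVn; apply: lerXn2r; rewrite ?nnegrE.
    - by rewrite divr_ge0; lra.
    - by rewrite invr_ge0; lra.
    - have : dyad J * t <= dyad J by rewrite ler_piMr// ltW.
      by rewrite ler_pdivrMr ?ler_pdivlMl; lra.
  by apply/andP; split; nra.
rewrite -sumrB; apply/andP; split; apply: ler_sum => j _.
  by have /andP[] := key j.
by have /andP[] := key j.
Qed.

(** Telescoping: with phi d = d / (d + r), which lies between 0 and 1, each term
    is at most (2 / r) * (phi (2 d) - phi d), and doubling d is one dyadic step. *)
Lemma dyadic_sum_le J r : 0 < r ->
  \sum_(j < J) dyad j.+1 / (dyad j.+1 + r) ^+ 2 <= 2 / r.
Proof.
move=> r0; pose phi d : R := d / (d + r).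
have phi0 d : 0 < d -> 0 <= phi d by move=> d0; rewrite divr_ge0; lra.
have step d : 0 < d -> d / (d + r) ^+ 2 <= 2 / r * (phi (2 * d) - phi d).
  move=> d0.
  have -> : 2 / r * (phi (2 * d) - phi d) = 2 * d / ((2 * d + r) * (d + r)).
    by rewrite /phi; field; rewrite !gt_eqF//; lra.
  rewrite ler_pdivlMr; last by rewrite mulr_gt0; lra.
  rewrite mulrAC ler_pdivrMr; last by rewrite exprn_gt0; lra.
  have : 0 < d * (d + r) * r by rewrite !mulr_gt0//; lra.
  by rewrite -subr_ge0 => /ltW; congr (0 <= _); ring.
apply: (@le_trans _ _ (2 / r * (phi 1 - phi (dyad J)))).
  elim: J => [|J IH]; first by rewrite big_ord0 /dyad expr0 subrr mulr0.
  rewrite big_ord_recr/=; have := step _ (dyad_gt0 J.+1); rewrite -dyadS.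
  lra.
rewrite ler_piMr ?divr_ge0//; first lra.
have : phi 1 <= 1 by rewrite ler_pdivrMr; lra.
by have := phi0 _ (dyad_gt0 J); lra.
Qed.

(** The derivative of the test function is, uniformly in J, as small as that of
    the logarithm: it is O(1 / r) at distance r from the point 1. *)
Lemma test_derive_le J z r : modulus z < 1 -> 0 < r ->
  (forall j, (j < J)%N -> (dyad j.+1 + r) / 2 <= dyad j.+1 + (1 - Re z) + `|Im z|) ->
  modulus (test_derive J z) <= 32 / r.
Proof.
move=> z1 r0 hr.
have tri (I : finType) (F : I -> C) : modulus (\sum_i F i) <= \sum_i modulus (F i).
  apply: (big_ind2 (fun (a : C) b => modulus a <= b)) => //.
    by rewrite -[0]/((0:R)%:C) modulus_real normr0.
  by move=> a b c d ab cd; apply: le_trans (le_normcD _ _) _; rewrite lerD.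
apply: (le_trans (tri _ _)).
apply: (@le_trans _ _ (16 * \sum_(j < J) dyad j.+1 / (dyad j.+1 + r) ^+ 2)); last first.
  by have := dyadic_sum_le J r0; lra.
rewrite mulr_sumr; apply: ler_sum => j _.
set d := dyad j.+1; have d0 : 0 < d := dyad_gt0 _.
have := hr _ (ltn_ord j); rewrite -/d => hj.
have hm := test_denom_modulus d0 z1.
rewrite modulusM modulusV modulusX modulus_real gtr0_norm//.
set m := modulus _ in hm *.
have hmr : (d + r) / 4 <= m by lra.
rewrite mulrCA ler_pM2l//.
have dr : 0 < d + r by lra.
have -> : 16 / (d + r) ^+ 2 = (((d + r) / 4) ^+ 2)^-1.
  by field; rewrite gt_eqF.
rewrite lef_pV2 ?posrE ?exprn_gt0//; try lra.
by rewrite lerXn2r ?nnegrE; lra.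
Qed.

End TestFunction.


(** * The Besov norm of the test functions *)

Section UpperBound.
Variable R : realType.
Local Notation C := R[i]^o.
Local Notation Re := (@complex.Re R).
Local Notation Im := (@complex.Im R).
Implicit Types (p q a b x y v K : R) (z : C).

(** One bound for exponents of either sign, so that p < 2 and p >= 2 need not be
    distinguished. *)
Lemma powR_le_of_bounds K v q : 1 <= K -> K^-1 <= v <= K -> v `^ q <= K `^ `|q|.
Proof.
move=> K1 /andP[v1 v2]; have K0 : 0 < K by lra.
have v0 : 0 < v by apply: lt_le_trans v1; rewrite invr_gt0.
have [q0|q0] := leP 0 q.
  by rewrite ger0_norm//; apply: ge0_ler_powR; rewrite ?nnegrE; lra.
rewrite ltr0_norm// -[q in v `^ q]opprK powRN.
have [r r0 ->] : exists2 r, 0 < r & - q = r by exists (- q) => //; lra.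
rewrite -[K `^ r]invrK lef_pV2 ?posrE ?invr_gt0 ?powR_gt0//.
have -> : (K `^ r)^-1 = K^-1 `^ r :> R.
  apply: (@mulfI _ (K `^ r)); first by rewrite gt_eqF// powR_gt0.
  rewrite mulfV ?gt_eqF ?powR_gt0// -powRM// ?invr_ge0 ?(ltW K0)//.
  by rewrite mulfV ?gt_eqF// powR1.
by apply: ge0_ler_powR; rewrite ?nnegrE// ?invr_ge0; lra.
Qed.

(** With s = sqrt (1 - b ^ 2), the weight is the product of (s - |a|) ^ (p - 2)
    and (s + |a|) ^ (p - 2).  The condition |b| <= |a| forces s >= 1 / 2, so the
    second factor is bounded above and below. *)
Lemma disc_weight_le p a b : a ^+ 2 + b ^+ 2 < 1 -> `|b| <= `|a| ->
  (1 - (a ^+ 2 + b ^+ 2)) `^ (p - 2) <=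
  2 `^ `|p - 2| * (Num.sqrt (1 - b ^+ 2) - `|a|) `^ (p - 2).
Proof.
move=> ab1 ba; set s := Num.sqrt _.
have hs := disc_slice ab1; rewrite -/s in hs.
have ha : `|a| < s by rewrite ltr_norml.
have a0 := normr_ge0 a; have b0 := normr_ge0 b.
have a2 : a ^+ 2 = `|a| ^+ 2 by rewrite real_normK// num_real.
have b2 : b ^+ 2 = `|b| ^+ 2 by rewrite real_normK// num_real.
have s2 : s ^+ 2 = 1 - b ^+ 2 by rewrite sqr_sqrtr//; have := sqr_ge0 a; lra.
have s1 : s <= 1 by have := sqr_ge0 b; nra.
have sh : 2^-1 <= s.
  have : b ^+ 2 <= a ^+ 2 by rewrite a2 b2 lerXn2r.
  nra.
have -> : 1 - (a ^+ 2 + b ^+ 2) = (s + `|a|) * (s - `|a|).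
  by rewrite opprD addrCA addrC -s2 a2; ring.
rewrite powRM; [|lra|lra].
rewrite ler_wpM2r ?powR_ge0// powR_le_of_bounds//; first lra.
by apply/andP; split; lra.
Qed.

Definition test_bound p : R := 32 `^ p * 2 `^ `|p - 2|.

Lemma density_le_kern p a b d m : 1 < p -> 0 < d ->
  a ^+ 2 + b ^+ 2 < 1 -> `|b| <= `|a| -> 0 <= m ->
  m <= 32 / (Num.sqrt (1 - b ^+ 2) - `|a| + `|b| + d) ->
  (1 - (a ^+ 2 + b ^+ 2)) `^ (p - 2) * m `^ p <=
  test_bound p * disc_kern p d a b.
Proof.
move=> p1 d0 ab1 ba m0; set s := Num.sqrt _ => hm.
have hs := disc_slice ab1; rewrite -/s in hs.
have ha : `|a| < s by rewrite ltr_norml.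
set r := _ + d in hm; have r0 : 0 < r by have := normr_ge0 b; rewrite /r; lra.
apply: (@le_trans _ _ (test_bound p * kern p (`|b| + d) (s - `|a|))).
  have h1 : m `^ p <= 32 `^ p * r `^ (- p).
    rewrite powRN; apply: (@le_trans _ _ ((32 / r) `^ p)).
      by apply: ge0_ler_powR; rewrite ?nnegrE//; [lra|rewrite divr_ge0// ltW].
    rewrite powRM ?invr_ge0 ?(ltW r0)//.
    rewrite -[r^-1]powR_inv1 ?(ltW r0)// -powRrM mulN1r powRN lexx//.
  have h2 := disc_weight_le p ab1 ba; rewrite -/s in h2.
  apply: (le_trans (ler_pM (powR_ge0 _ _) (powR_ge0 _ _) h2 h1)).
  by rewrite /test_bound /kern addrA -/r le_eqVlt; apply/orP; left; apply/eqP; ring.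
rewrite ler_wpM2l ?mulr_ge0 ?powR_ge0// /disc_kern -/s.
have [a0|a0] := leP 0 a.
  by rewrite (ger0_norm a0) lerDr kern_ge0.
by rewrite (ltr0_norm a0) opprK lerDl kern_ge0.
Qed.

(** Where |y| <= |x| the horizontal chord controls the distance to the boundary,
    and elsewhere the vertical one does.  In the second case z stays away from 1,
    so that the distances to 1 in both systems are comparable. *)
Lemma test_density_le p J x y : 1 < p -> x ^+ 2 + y ^+ 2 < 1 ->
  besov_density p (test_fun J) (x +i* y) <=
  test_bound p * (disc_kern p (dyad R J) x y + disc_kern p (dyad R J) y x).
Proof.
move=> p1 xy1; set z : C := x +i* y; set d := dyad R J.
have d0 : 0 < d := dyad_gt0 R J.
have tb0 : 0 <= test_bound p by rewrite mulr_ge0 ?powR_ge0.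
have z1 : modulus z < 1 by rewrite modulus_lt1.
rewrite /besov_density modulus_sqr /=.
have -> : derive1 (test_fun J) z = test_derive J z.
  by rewrite derive1E; have [] := is_derive_test_fun J z1.
have m0 := modulus_ge0 (test_derive J z).
have x1 : x <= `|x| := ler_norm x.
have ny := normr_ge0 y; have nx := normr_ge0 x.
have sq1 b : Num.sqrt (1 - b ^+ 2) <= 1.
  rewrite -[leRHS]sqrtr1 ler_wsqrtr// lerBlDr lerDl sqr_ge0//.
have [yx|xy] := leP `|y| `|x|.
  apply: (@le_trans _ _ (test_bound p * disc_kern p d x y)).
    apply: density_le_kern => //.
    have := disc_slice xy1; rewrite -ltr_norml; have := sq1 y => hs1 hs.
    apply: test_derive_le => //=; first lra.
    by move=> j jJ; have := dyad_le R jJ; rewrite -/d; lra.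
  by rewrite ler_wpM2l// lerDl disc_kern_ge0.
apply: (@le_trans _ _ (test_bound p * disc_kern p d y x)).
  rewrite addrC in xy1; rewrite [x ^+ 2 + _]addrC.
  apply: density_le_kern => //; first exact: ltW.
  have := disc_slice xy1; rewrite -ltr_norml; have := sq1 x => hs1 hs.
  apply: test_derive_le => //=; first lra.
  by move=> j jJ; have := dyad_le R jJ; rewrite -/d; lra.
by rewrite ler_wpM2l// lerDr disc_kern_ge0.
Qed.

(** The p-th power of the seminorm grows only linearly in J, the number of dyadic
    scales, whereas the triangle inequality would give J ^ p. *)
Lemma test_area_integral_le p J : 1 < p -> (0 < J)%N ->
  (area_integral_disc (besov_density p (test_fun J)) <=
   (pi^-1 * (test_bound p * (16 / (p - 1))) * J%:R)%:E)%E.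
Proof.
move=> p1 J0; set d := dyad R J; have d0 : 0 < d := dyad_gt0 R J.
have p10 : 0 < p - 1 by rewrite subr_gt0.
have tb0 : 0 <= test_bound p by rewrite mulr_ge0 ?powR_ge0.
rewrite /area_integral_disc -mulrA EFinM; apply: lee_wpmul2l.
  by rewrite lee_fin invr_ge0 pi_ge0.
set K := fun w : R * R => disc_kern p d w.1 w.2.
set K' := fun w : R * R => disc_kern p d w.2 w.1.
have mK : measurable_fun (@unit_disc R) (fun w => (K w)%:E).
  by apply: measurable_funTS; apply/measurable_EFinP; exact: measurable_disc_kern.
have mK' : measurable_fun (@unit_disc R) (fun w => (K' w)%:E).
  by apply: measurable_funTS; apply/measurable_EFinP; exact: measurable_disc_kern.
apply: (@le_trans _ _ (\int[lebesgue_measure \x lebesgue_measure]_(w in @unit_disc R)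
   ((test_bound p)%:E * ((K w)%:E + (K' w)%:E)))%E).
  apply: ge0_le_integral_nomeas => -[x y]; rewrite /unit_disc/= => xy.
    by rewrite lee_fin mulr_ge0 ?powR_ge0.
  by rewrite -EFinD -EFinM lee_fin test_density_le.
rewrite ge0_integralZl_EFin//; last 3 first.
- exact: measurable_unit_disc.
- by move=> w _; rewrite -EFinD lee_fin addr_ge0 ?disc_kern_ge0.
- exact: emeasurable_funD.
rewrite -mulrA (EFinM (test_bound p)); apply: lee_wpmul2l; first by rewrite lee_fin.
rewrite ge0_integralD//; try exact: measurable_unit_disc;
  try by move=> w _; rewrite lee_fin disc_kern_ge0.
apply: (@le_trans _ _ ((4 / (p - 1) * ln ((1 + d) / d))%:E + (4 / (p - 1) * ln ((1 + d) / d))%:E)%E).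
  apply: leeD; first exact: disc_kern_integral_le.
  exact: disc_kern_swap_integral_le.
have hl : ln ((1 + d) / d) <= 2 * J%:R.
  apply: (@le_trans _ _ (ln (2 ^+ J.+1))).
    rewrite ler_ln ?posrE ?exprn_gt0 ?divr_gt0 ?addr_gt0// ler_pdivrMr//.
    rewrite exprS -mulrA.
    have -> : 2 ^+ J * d = 1 by rewrite -exprMn mulfV// expr1n.
    by have := dyad_le1 R J; rewrite -/d; lra.
  rewrite lnXn// -[ln 2 *+ _]mulr_natl.
  have l2 : ln 2 <= 1 :> R.
    by have := @le_ln1Dx R 1; rewrite -[1 + 1]/2; apply.
  have l0 : 0 <= ln 2 :> R by rewrite ln_ge0// ler1n.
  have J1 : J.+1%:R <= 2 * J%:R :> R.
    by rewrite -natrM ler_nat mul2n -addnn -addn1 leq_add2l.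
  by apply: le_trans J1; rewrite ler_piMr.
rewrite -EFinD lee_fin.
have c0 : 0 < (p - 1)^-1 by rewrite invr_gt0.
nra.
Qed.

Lemma area_integral_besov_ge0 p (f : C -> C) :
  (0 <= area_integral_disc (besov_density p f))%E.
Proof.
rewrite mule_ge0// ?lee_fin ?invr_ge0 ?pi_ge0//.
by apply: integral_ge0 => w _; rewrite lee_fin mulr_ge0 ?powR_ge0.
Qed.

(** Growth J ^ (1 / p) of the norm, to be compared with the growth J of the
    values on the real axis. *)
Lemma test_besov p J : 1 < p -> (0 < J)%N ->
  besov p (test_fun (R := R) J) /\
  (besov_norm p (test_fun (R := R) J) <=
   ((1 + (pi^-1 * (test_bound p * (16 / (p - 1)))) `^ p^-1) * J%:R `^ p^-1)%:E)%E.
Proof.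
move=> p1 J0; set c := pi^-1 * _.
have c0 : 0 <= c.
  rewrite !mulr_ge0 ?powR_ge0 ?invr_ge0 ?pi_ge0//; lra.
have hs : (besov_seminorm p (test_fun (R := R) J) <= (c `^ p^-1 * J%:R `^ p^-1)%:E)%E.
  rewrite -powRM// /besov_seminorm -poweR_EFin; apply: gt0_ler_poweR.
  - by rewrite invr_ge0; lra.
  - by rewrite in_itv/= leey area_integral_besov_ge0.
  - by rewrite in_itv/= leey lee_fin mulr_ge0.
  - exact: test_area_integral_le.
split.
  split; last by apply: le_lt_trans hs _; rewrite ltry.
  by move=> z; rewrite norm_lt1 => z1; have [] := is_derive_test_fun J z1.
rewrite mulrDl mul1r EFinD; apply: leeD => //.
rewrite lee_fin -[0 : C]/((0 : R)%:C) test_fun_real modulus_real ger0_norm ?test_real_ge0//.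
apply: (le_trans (test_real0_le1 _ _)).
by rewrite -[leLHS](powRr0 J%:R); apply: ler_powR; rewrite ?ler1n ?invr_ge0//; lra.
Qed.

End UpperBound.


(** * Coefficients of the image of a test function *)

Section Hankel.
Variable R : realType.
Variable mu : {finite_measure set (measurableTypeR R) -> \bar R}.
Local Notation C := R[i]^o.
Local Notation Re := (@complex.Re R).
Local Notation Im := (@complex.Im R).
Local Notation I01 := (`[0%R, 1%R[%classic : set (measurableTypeR R)).
Local Notation E f := (\int[mu]_(t in `[0, 1[) f t).
Local Notation intb f := (mu.-integrable I01 (EFin \o f)).
Implicit Types (z : C) (t a x y h : R) (J n k N : nat).

Let mI : measurable I01. Proof. exact: measurable_itv. Qed.

Lemma integrable_bounded01 (g : R -> R) (M : R) : measurable_fun I01 g ->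
  (forall t, 0 <= t < 1 -> `|g t| <= M) -> intb g.
Proof.
move=> mg gM; apply: measurable_bounded_integrable => //.
- by rewrite ltey_eq fin_num_measure.
- exists M; split; first exact: num_real.
  move=> x Mx t; rewrite /= in_itv/= => /gM h.
  exact: le_trans h (ltW Mx).
Qed.

Lemma Rintegral_sum01 (g : nat -> R -> R) N : (forall n, intb (g n)) ->
  intb (fun t => \sum_(n < N) g n t) /\
  E (fun t => \sum_(n < N) g n t) = \sum_(n < N) E (g n).
Proof.
move=> ig; have H m : intb (fun t => \sum_(n < m) g n t).
  rewrite (_ : _ \o _ = fun t => (\sum_(n <- enum 'I_m) (g n t)%:E)%E).
    by apply: integrable_sum => // n _; exact: ig.
  by apply/funext => t /=; rewrite sumEFin big_enum.
split=> //; elim: N => [|N IH].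
  under eq_Rintegral do rewrite big_ord0.
  by rewrite big_ord0 Rintegral_cst// mul0r.
rewrite [RHS]big_ord_recr/= -IH -RintegralD//.
by apply: eq_Rintegral => t _; rewrite big_ord_recr.
Qed.

Variable J : nat.
Local Notation f := (test_real (R := R) J).
Local Notation F := (f 1).
Local Notation c := (fun k => (test_coef R J k)%:C : C).


Lemma measurable_test_real : measurable_fun I01 f.
Proof.
apply: (@eq_measurable_fun _ _ _ _ _ (fun t : R =>
    \sum_(j <- enum 'I_J) dyad R j.+1 * (1 + dyad R j.+1 - t) `^ (-1))).
  move=> t; rewrite inE/= in_itv/= => /andP[t0 t1].
  rewrite big_enum; apply: eq_bigr => j _; rewrite powR_inv1//.
  have := dyad_gt0 R j.+1; lra.
apply: measurable_sum => j; apply: measurable_funTS; apply: measurable_funM => //.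
apply: (measurableT_comp (measurable_powR _)).
exact: measurable_funB.
Qed.

Lemma test_real_bound01 t : 0 <= t < 1 -> `|f t| <= F.
Proof.
move=> /andP[t0 t1]; rewrite ger0_norm ?test_real_ge0//; last exact: ltW.
by apply: test_real_mono => //; exact: ltW.
Qed.

Lemma integrable_monomial_test n : intb (fun t => t ^+ n * f t).
Proof.
apply: (@integrable_bounded01 _ F).
  apply: measurable_funM; last exact: measurable_test_real.
  by apply: measurable_funTS; exact: measurable_funX.
move=> t /[dup] tI /andP[t0 t1]; rewrite normrM.
apply: (@le_trans _ _ (1 * F)); last by rewrite mul1r.
apply: ler_pM => //; last exact: test_real_bound01.
by rewrite ger0_norm ?exprn_ge0// exprn_ile1// ltW.
Qed.

Lemma integrable_monomial n : intb (fun t => t ^+ n).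
Proof.
apply: (@integrable_bounded01 _ 1).
  by apply: measurable_funTS; exact: measurable_funX.
move=> t /andP[t0 t1].
by rewrite ger0_norm ?exprn_ge0// exprn_ile1// ltW.
Qed.

Definition hcoef n : R := E (fun t => t ^+ n * f t).

Lemma hankel_inner_real n K : hankel_inner mu c n K =
  (E (fun t => t ^+ n * \sum_(k < K) test_coef R J k * t ^+ k))%:C.
Proof.
have im k : intb (fun t => test_coef R J k * t ^+ (n + k)).
  by have := integrableZl mI (test_coef R J k) (integrable_monomial (n + k)).
rewrite (_ : E (fun t => t ^+ n * \sum_(k < K) test_coef R J k * t ^+ k) =
    \sum_(k < K) moment mu (n + k) * test_coef R J k).
  by rewrite /hankel_inner /series/= big_mkord rmorph_sum/=; apply: eq_bigr => k _; rewrite rmorphM.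
transitivity (E (fun t => \sum_(k < K) test_coef R J k * t ^+ (n + k))).
  apply: eq_Rintegral => t _; rewrite mulr_sumr; apply: eq_bigr => k _.
  by rewrite exprD; ring.
rewrite (Rintegral_sum01 K im).2; apply: eq_bigr => k _.
by rewrite RintegralZl//; [rewrite mulrC|exact: integrable_monomial].
Qed.

(** The inner series may be summed under the integral by the uniform convergence
    of test_real_partial, the measure being finite. *)
Lemma hankel_coefE n : hankel_coef mu c n = (hcoef n)%:C.
Proof.
apply: cvg_lim => //.
rewrite (funext (hankel_inner_real n)).
apply: cvg_real_complex.
pose e K : R := J%:R * (1 + dyad R J) ^- K.
have e0 : e @ \oo --> (0 : R).
  rewrite -(mulr0 J%:R); apply: cvgM; first exact: cvg_cst.
  rewrite (_ : (fun K => _) = (fun K => (1 + dyad R J)^-1 ^+ K)); last first.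
    by apply/funext => K; rewrite exprVn.
  have d0 := dyad_gt0 R J.
  by apply: cvg_expr; rewrite ger0_norm ?invr_ge0 ?invf_lt1; lra.
have icst (r : R) : intb (fun=> r).
  by apply: (@integrable_bounded01 _ `|r|).
have ip K : intb (fun t => t ^+ n * \sum_(k < K) test_coef R J k * t ^+ k).
  have ik k : intb (fun t => test_coef R J k * t ^+ (n + k)).
    by have := integrableZl mI (test_coef R J k) (integrable_monomial (n + k)).
  have := (Rintegral_sum01 K ik).1; congr (integrable _ _ _); apply/funext => t /=.
  by congr EFin; rewrite mulr_sumr; apply: eq_bigr => k _; rewrite exprD; ring.
have key K t : I01 t -> t ^+ n * f t - e K <=
    t ^+ n * (\sum_(k < K) test_coef R J k * t ^+ k) <= t ^+ n * f t.
  rewrite /= in_itv/= => /andP[t0 t1].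
  have := @test_real_partial R J t K; rewrite t0 ltW// => /(_ isT) /andP[h1 h2].
  have n0 : 0 <= t ^+ n by rewrite exprn_ge0.
  have n1 : t ^+ n <= 1 by rewrite exprn_ile1// ltW.
  rewrite [X in _ && X]ler_wpM2l// andbT.
  have eK0 : 0 <= e K.
    by rewrite mulr_ge0// invr_ge0 exprn_ge0// addr_ge0// ltW// dyad_gt0.
  apply: (@le_trans _ _ (t ^+ n * (f t - e K))); last by rewrite ler_wpM2l.
  by rewrite mulrBr lerB// ler_piMl.
have hl : (fun K => hcoef n - e K * fine (mu I01)) @ \oo --> hcoef n.
  rewrite -[X in _ --> X]subr0 -[X in _ - X](mul0r (fine (mu I01))).
  by apply: cvgB; [exact: cvg_cst|apply: cvgM => //; exact: cvg_cst].
apply: squeeze_cvgr hl (cvg_cst _); apply: nearW => K; apply/andP; split.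
  rewrite -Rintegral_cst// -RintegralB//; last exact: integrable_monomial_test.
  apply: le_Rintegral => //.
    by have := integrableB mI (integrable_monomial_test n) (icst (e K)).
  by move=> t tI; have /andP[] := key K t tI.
apply: le_Rintegral => //; first exact: integrable_monomial_test.
by move=> t tI; have /andP[] := key K t tI.
Qed.

End Hankel.


(** * The real part of the Cauchy kernel *)

Section RealKernel.
Variable R : realType.
Local Notation C := R[i]^o.
Local Notation Re := (@complex.Re R).
Local Notation Im := (@complex.Im R).
Implicit Types (z : C) (t a x y h : R) (N : nat).

(** The real part of 1 / (1 - t z) for z = x + i y. *)
Definition cauchy_re t x y : R := (1 - t * x) / ((1 - t * x) ^+ 2 + (t * y) ^+ 2).

Lemma Re_realM (r : R) z : Re (r%:C * z) = r * Re z.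
Proof. by case: z => a b /=; rewrite mul0r subr0. Qed.

Lemma cauchy_re_partial t z N : 0 <= t <= 1 -> modulus z < 1 ->
  `|cauchy_re t (Re z) (Im z) - \sum_(n < N) t ^+ n * Re (z ^+ n)| <=
  modulus z ^+ N / (1 - modulus z).
Proof.
move=> /andP[t0 t1] z1; pose w : C := t%:C * z.
have z0 := modulus_ge0 z.
have wz : modulus w <= modulus z.
  by rewrite modulusM modulus_real ger0_norm// ler_piMl.
have w1 : modulus w < 1 by apply: le_lt_trans wz z1.
have -> : cauchy_re t (Re z) (Im z) = Re ((1 - w)^-1).
  rewrite /w /cauchy_re; case: (z) => a b /=.
  by rewrite !mul0r subr0 addr0 add0r sqrrN.
have -> : \sum_(n < N) t ^+ n * Re (z ^+ n) = Re (\sum_(n < N) w ^+ n).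
  rewrite raddf_sum; apply: eq_bigr => n _.
  have -> : w ^+ n = (t ^+ n)%:C * z ^+ n by rewrite /w exprMn rmorphXn.
  exact: (esym (Re_realM _ _)).
rewrite -raddfB; apply: (le_trans (Re_le_modulus _)).
apply: (le_trans (modulus_geometric_tail N w1)).
apply: ler_pM; rewrite ?invr_ge0 ?exprn_ge0 ?modulus_ge0//; first lra.
  by rewrite lerXn2r ?nnegrE ?modulus_ge0.
by rewrite lef_pV2 ?posrE; lra.
Qed.

(** Write A and A' for 1 - t x and 1 - t (x + h), and B for t y.  The increment is
    t h (A A' - B ^ 2) / ((A' ^ 2 + B ^ 2) (A ^ 2 + B ^ 2)).  The bound on y keeps
    B below A' / 2, so it is nonnegative for all t, and it is of the order of
    t h / A ^ 2 with A <= 2 (1 - a) as soon as t >= a. *)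
Lemma cauchy_re_increment t a x y h : 0 <= t < 1 -> 2^-1 <= a < 1 ->
  a <= x <= (1 + a) / 2 -> 0 <= y <= (1 - a) / 8 -> 0 < h <= (1 - a) / 4 ->
  0 <= cauchy_re t (x + h) y - cauchy_re t x y /\
  (a <= t -> h / (20 * (1 - a) ^+ 2) <= cauchy_re t (x + h) y - cauchy_re t x y).
Proof.
move=> /andP[t0 t1] /andP[ah a1] /andP[ax xa] /andP[y0 ya] /andP[h0 ha].
rewrite /cauchy_re.
set A := 1 - t * x; set A' := 1 - t * (x + h); set B := t * y.
have txh : t * (x + h) <= x + h by rewrite ler_piMl; lra.
have A'a : (1 - a) / 4 <= A' by rewrite /A'; lra.
have th0 : 0 <= t * h by rewrite mulr_ge0; lra.
have AA' : A - A' = t * h by rewrite /A /A'; ring.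
have B0 : 0 <= B by rewrite mulr_ge0.
have BA : B <= A' / 2.
  have : t * y <= y by rewrite ler_piMl; lra.
  rewrite -/B; lra.
have A'0 : 0 < A' by lra.
have A0 : 0 < A by lra.
have B2 : B ^+ 2 <= A' ^+ 2 / 4.
  have : B ^+ 2 <= (A' / 2) ^+ 2 by rewrite lerXn2r ?nnegrE; lra.
  by move=> /le_trans; apply; rewrite expr_div_n; lra.
have P0 : 0 < A ^+ 2 + B ^+ 2 by rewrite ltr_wpDr ?sqr_ge0 ?exprn_gt0.
have P'0 : 0 < A' ^+ 2 + B ^+ 2 by rewrite ltr_wpDr ?sqr_ge0 ?exprn_gt0.
have A'A : A' <= A by lra.
have A2 : A' ^+ 2 <= A * A' by rewrite expr2 ler_wpM2r// ltW.
have A3 : A * A' <= A ^+ 2 by rewrite expr2 ler_wpM2l// ltW.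
have -> : A' / (A' ^+ 2 + B ^+ 2) - A / (A ^+ 2 + B ^+ 2) =
    (t * h) * ((A * A' - B ^+ 2) / ((A' ^+ 2 + B ^+ 2) * (A ^+ 2 + B ^+ 2))).
  by rewrite -AA'; field; rewrite !gt_eqF.
have N0 : (3 / 4) * (A * A') <= A * A' - B ^+ 2 by lra.
have AA0 : 0 < A * A' by rewrite mulr_gt0.
split.
  rewrite mulr_ge0// divr_ge0//; first by lra.
  by rewrite mulr_ge0// ltW.
move=> at_.
have A1 : A <= 2 * (1 - a).
  have : a * a <= t * x by rewrite ler_pM//; lra.
  by have := sqr_ge0 (1 - a); rewrite /A; lra.
have den : (A' ^+ 2 + B ^+ 2) * (A ^+ 2 + B ^+ 2) <= 25 / 16 * (A * A') * A ^+ 2 * 1.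
  have h1 : A' ^+ 2 + B ^+ 2 <= 5 / 4 * (A * A') by lra.
  have h2 : A ^+ 2 + B ^+ 2 <= 5 / 4 * A ^+ 2 by lra.
  apply: (le_trans (ler_pM (ltW P'0) (ltW P0) h1 h2)).
  by rewrite le_eqVlt; apply/orP; left; apply/eqP; field.
have q : 12 / 25 / A ^+ 2 <= (A * A' - B ^+ 2) / ((A' ^+ 2 + B ^+ 2) * (A ^+ 2 + B ^+ 2)).
  apply: (@le_trans _ _ ((3 / 4) * (A * A') / (25 / 16 * (A * A') * A ^+ 2 * 1))).
    rewrite le_eqVlt; apply/orP; left; apply/eqP.
    field.
    by rewrite !gt_eqF.
  apply: ler_pM => //.
  - by lra.
  - by rewrite invr_ge0 !mulr_ge0 ?sqr_ge0//; lra.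
  - rewrite lef_pV2 ?posrE// ?mulr_gt0 ?exprn_gt0//; lra.
have q2 : 12 / 25 / (4 * (1 - a) ^+ 2) <= 12 / 25 / A ^+ 2.
  rewrite ler_pM2l// lef_pV2 ?posrE ?exprn_gt0//; last first.
    by rewrite mulr_gt0// exprn_gt0; lra.
  have : A ^+ 2 <= (2 * (1 - a)) ^+ 2 by rewrite lerXn2r ?nnegrE; lra.
  by rewrite exprMn; lra.
apply: (@le_trans _ _ ((2^-1 * h) * (12 / 25 / (4 * (1 - a) ^+ 2)))).
  have i0 : 0 < ((1 - a) ^+ 2)^-1 by rewrite invr_gt0 exprn_gt0; lra.
  rewrite !invfM.
  have := mulr_gt0 h0 i0; lra.
apply: ler_pM => //.
- by rewrite mulr_ge0//; lra.
- by rewrite divr_ge0// mulr_ge0// sqr_ge0.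
- by rewrite ler_pM2r//; lra.
- exact: le_trans q2 q.
Qed.
End RealKernel.


(** * Growth of the image of a test function along the real direction *)

Section ComplexDerivative.
Variable R : realType.
Local Notation C := R[i]^o.
Local Notation Re := (@complex.Re R).

(** The real part of a complex derivative can be computed from increments of the
    real part along the real direction. *)
Lemma cvg_Re_derive1 (G : C -> C) (z : C) (h : nat -> R) : derivable G z 1 ->
  h @ \oo --> (0 : R) -> (forall n, h n != 0) ->
  (fun n => (h n)^-1 * (Re (G ((h n)%:C + z)) - Re (G z))) @ \oo -->
  Re (derive1 G z).
Proof.
move=> dz h0 hn0.
have hC : (fun n => (h n)%:C : C) @ \oo --> (0 : C)^'.
  have hC0 : (fun n => (h n)%:C : C) @ \oo --> (0%:C : C) by exact: cvg_real_complex.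
  move=> A nA.
  have hA : \forall n \near \oo, (h n)%:C != 0 :> C -> A (h n)%:C by exact: hC0 nA.
  suff : \forall n \near \oo, A (h n)%:C by [].
  by apply: filterS hA => n; apply; apply/eqP => -[] /eqP; rewrite (negbTE (hn0 n)).
have lim0 : (fun h : C => h^-1 *: ((G \o shift z) (h *: (1 : C)) - G z)) @ (0 : C)^'
    --> derive1 G z.
  by rewrite derive1E; exact: dz.
have /cvg_Re := cvg_comp _ _ hC lim0.
suff -> : (fun n => (h n)^-1 * (Re (G ((h n)%:C + z)) - Re (G z))) =
  (fun n => Re (((fun h : C => h^-1 *: ((G \o shift z) (h *: (1 : C)) - G z)) \o
    (fun n => (h n)%:C : C)) n)) by [].
apply/funext => n /=.
have -> : (h n)%:C *: (1 : C) = (h n)%:C by rewrite /GRing.scale/= mulr1.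
have -> : (h n)%:C^-1 *: (G ((h n)%:C + z) - G z) =
    ((h n)^-1)%:C * (G ((h n)%:C + z) - G z) by rewrite fmorphV.
by rewrite Re_realM raddfB.
Qed.

End ComplexDerivative.

Section HankelIncrement.
Variable R : realType.
Variable mu : {finite_measure set (measurableTypeR R) -> \bar R}.
Variable J : nat.
Local Notation C := R[i]^o.
Local Notation Re := (@complex.Re R).
Local Notation Im := (@complex.Im R).
Local Notation I01 := (`[0%R, 1%R[%classic : set (measurableTypeR R)).
Local Notation E f := (\int[mu]_(t in `[0, 1[) f t).
Local Notation intb f := (mu.-integrable I01 (EFin \o f)).
Local Notation f := (test_real (R := R) J).
Local Notation F := (f 1).
Local Notation c := (fun k => (test_coef R J k)%:C : C).
Hypothesis wd : hankel_well_defined mu c.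
Implicit Types (z w : C) (t a x y h : R) (n k N : nat).

Let mI : measurable I01. Proof. exact: measurable_itv. Qed.

Definition tail_mass a : R := fine (mu `[a, 1%R[%classic).

Lemma cvg_Re_hankel z : modulus z < 1 ->
  (fun N => \sum_(n < N) hcoef mu J n * Re (z ^+ n)) @ \oo --> Re (hankel mu c z).
Proof.
move=> z1; have [_ cv _] := wd.
have {cv} /cvg_Re := cv z (etrans (norm_lt1 z) z1).
rewrite (_ : (fun N => complex.Re _) = (fun N => \sum_(n < N) hcoef mu J n * Re (z ^+ n))) //.
apply/funext => N; rewrite /series/= big_mkord raddf_sum; apply: eq_bigr => n _.
by rewrite hankel_coefE; exact: Re_realM.
Qed.

Lemma partial_sum_integral (v : nat -> R) N :
  intb (fun t => f t * \sum_(n < N) t ^+ n * v n) /\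
  \sum_(n < N) hcoef mu J n * v n = E (fun t => f t * \sum_(n < N) t ^+ n * v n).
Proof.
have iv n : intb (fun t => v n * (t ^+ n * f t)).
  by have := integrableZl mI (v n) (integrable_monomial_test mu J n).
have [h1 h2] := Rintegral_sum01 N iv.
have e t : \sum_(n < N) v n * (t ^+ n * f t) = f t * \sum_(n < N) t ^+ n * v n.
  by rewrite mulr_sumr; apply: eq_bigr => n _; ring.
split; first by move: h1; congr (integrable _ _ _); apply/funext => t /=; rewrite e.
transitivity (E (fun t => \sum_(n < N) v n * (t ^+ n * f t))); last first.
  by apply: eq_Rintegral => t _; rewrite e.
rewrite h2; apply: eq_bigr => n _.
by rewrite RintegralZl//; [rewrite mulrC|exact: integrable_monomial_test].
Qed.

(** Triangle inequality for two approximations, kept apart from the integrals to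
    which it is applied. *)
Lemma increment_perturb (u v su sv eu ev : R) :
  `|u - su| <= eu -> `|v - sv| <= ev -> u - v - (eu + ev) <= su - sv.
Proof. by rewrite !ler_norml => /andP[? ?] /andP[? ?]; lra. Qed.

(** Formally the image is the integral of f t / (1 - t z) against mu, so an
    increment of its real part is the integral of f t times an increment of
    cauchy_re.  If the latter is nonnegative everywhere and at least kappa for
    t >= a, only the mass of [a, 1) matters, because f is nonnegative and
    increasing.  The proof works with the polynomials that truncate the Cauchy
    kernel and lets the truncation error, which is uniform in t, tend to 0. *)
Lemma hankel_Re_increment z w a kappa : modulus z < 1 -> modulus w < 1 ->
  0 <= a < 1 -> 0 <= kappa ->
  (forall t, 0 <= t < 1 ->
    let D := cauchy_re t (Re w) (Im w) - cauchy_re t (Re z) (Im z) in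
    0 <= D /\ (a <= t -> kappa <= D)) ->
  f a * kappa * tail_mass a <= Re (hankel mu c w) - Re (hankel mu c z).
Proof.
move=> z1 w1 /andP[a0 a1] k0 hD.
pose e u N : R := modulus u ^+ N / (1 - modulus u).
have ecvg u : modulus u < 1 -> e u @ \oo --> (0 : R).
  move=> u1; rewrite -(mul0r (1 - modulus u)^-1); apply: cvgM; last exact: cvg_cst.
  by apply: cvg_expr; rewrite ger0_norm// modulus_ge0.
have e0 u N : modulus u < 1 -> 0 <= e u N.
  by move=> u1; rewrite divr_ge0 ?exprn_ge0 ?modulus_ge0// subr_ge0 ltW.
have hlow : (fun N => f a * kappa * tail_mass a - F * (e w N + e z N) * fine (mu I01))
    @ \oo --> f a * kappa * tail_mass a.
  rewrite -[X in _ --> X]subr0; apply: cvgB; first exact: cvg_cst.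
  have h0 : F * (0 + 0) * fine (mu I01) = 0 by rewrite addr0 mulr0 mul0r.
  rewrite -[X in _ --> X]h0.
  exact: (cvgM (cvgM (cvg_cst F) (cvgD (ecvg w w1) (ecvg z z1))) (cvg_cst (fine (mu I01)))).
have hup := cvgB (cvg_Re_hankel w1) (cvg_Re_hankel z1).
apply: (ler_cvg_to hlow (hup _)); apply: nearW => N /=.
have /= [iw ew] := partial_sum_integral (fun n => Re (w ^+ n)) N.
have /= [iz ez] := partial_sum_integral (fun n => Re (z ^+ n)) N.
rewrite !fctE ew ez -RintegralB//.
have F0 : 0 <= F by rewrite test_real_ge0.
have fa0 : 0 <= f a by rewrite test_real_ge0// ltW.
set A : set (measurableTypeR R) := `[a, 1%R[%classic.
have mA : measurable A by exact: measurable_itv.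
have i1 : intb (fun t => f a * kappa * \1_A t).
  apply: (@integrable_bounded01 _ _ _ (f a * kappa)).
    by apply: measurable_funM => //; apply: measurable_funTS; exact: measurable_indic.
  move=> t _; rewrite normrM ger0_norm ?mulr_ge0//.
  by rewrite ler_piMr ?mulr_ge0// indicE; case: (_ \in _); rewrite ?normr1 ?normr0.
have i2 : intb (fun=> F * (e w N + e z N)).
  exact: (@integrable_bounded01 _ _ _ `|F * (e w N + e z N)|).
have -> : f a * kappa * tail_mass a = E (fun t => f a * kappa * \1_A t).
  have ii : intb (\1_A : R -> R).
    apply: (@integrable_bounded01 _ _ _ 1).
      by apply: measurable_funTS; exact: measurable_indic.
    by move=> t _; rewrite indicE; case: (_ \in _); rewrite ?normr1 ?normr0.
  rewrite RintegralZl//; congr (_ * _).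
  rewrite /Rintegral integral_indic//; congr fine; congr (mu _).
  apply/seteqP; split => t /=; rewrite /A/= !in_itv/=; last by case.
  by move=> /andP[h1 h2]; rewrite h1 h2 (le_trans a0).
rewrite -Rintegral_cst// -RintegralB//.
apply: le_Rintegral => //.
- by have := integrableB mI i1 i2.
- by have := integrableB mI iw iz.
move=> t; rewrite /= in_itv/= => tI; have /andP[t0 t1] := tI.
have [D0 D1] := hD t tI.
have t01 : 0 <= t <= 1 by rewrite t0 ltW.
have pw := cauchy_re_partial N t01 w1.
have pz := cauchy_re_partial N t01 z1.
rewrite -/(e w N) in pw; rewrite -/(e z N) in pz.
have {pw pz} hS := increment_perturb pw pz.
rewrite -mulrBr; set D := _ - _ in D0 D1 hS.
set S := \sum_(n < N) _ - _ in hS *.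
have ft0 : 0 <= f t by rewrite test_real_ge0// ltW.
have ftF : f t <= F by apply: test_real_mono => //; exact: ltW.
apply: (@le_trans _ _ (f t * (D - (e w N + e z N)))); last by rewrite ler_wpM2l.
rewrite mulrBr lerB//; last first.
  by rewrite ler_wpM2r// addr_ge0 ?e0.
rewrite indicE; have [tA|tA] := boolP (t \in A); last by rewrite mulr0 mulr_ge0.
have at_ : a <= t by move: tA; rewrite inE /A/= in_itv/= => /andP[].
by rewrite mulr1 ler_pM// ?D1// test_real_mono// ltW.
Qed.

(** On the rectangle above the segment from a to (1 + a) / 2, of height
    (1 - a) / 8, the derivative has the size of f a * mu [a, 1) / (1 - a) ^ 2.
    Real increments give it pointwise, without differentiating the power series
    of the image. *)
Lemma hankel_derive_ge a x y : 2^-1 <= a < 1 ->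
  a <= x <= (1 + a) / 2 -> 0 <= y <= (1 - a) / 8 ->
  f a * tail_mass a / (20 * (1 - a) ^+ 2) <=
  modulus (derive1 (hankel mu c) (x +i* y)).
Proof.
move=> /[dup] aI /andP[ah a1] /[dup] xI /andP[ax xa] /[dup] yI /andP[y0 ya].
set z : C := x +i* y; set H := hankel mu c.
have disc h : 0 <= h <= (1 - a) / 4 -> modulus ((x + h) +i* y : C) < 1.
  move=> /andP[h0 h1]; rewrite modulus_lt1/=.
  have b1 : x + h <= 1 - (1 - a) / 4 by lra.
  have b2 : (x + h) ^+ 2 <= (1 - (1 - a) / 4) ^+ 2 by rewrite lerXn2r ?nnegrE; lra.
  have b3 : y ^+ 2 <= ((1 - a) / 8) ^+ 2 by rewrite lerXn2r ?nnegrE; lra.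
  have b4 : 0 < (1 - a) * (1 - a) by rewrite mulr_gt0; lra.
  have b5 : (1 - a) * (1 - a) <= (1 - a) * 2^-1 by rewrite ler_pM2l; lra.
  have := lerD b2 b3; lra.
have z1 : modulus z < 1 by have := disc 0; rewrite addr0; apply; lra.
(* Steps of at most (1 - a) / 4 keep the moved point inside the disc. *)
pose hn n : R := (1 - a) / 4 * n.+1%:R^-1.
have hn0 n : 0 < hn n by rewrite mulr_gt0 ?invr_gt0 ?ltr0n//; lra.
have hn1 n : hn n <= (1 - a) / 4.
  by rewrite ler_piMr ?invf_le1 ?ltr0n ?ler1n//; lra.
have hn00 : hn @ \oo --> (0 : R).
  by rewrite -(mulr0 ((1 - a) / 4)); apply: cvgM; [exact: cvg_cst|exact: cvg_harmonic].
have [_ _ an] := wd.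
have dz : derivable H z 1 by apply: an; rewrite norm_lt1.
have hlim := cvg_Re_derive1 dz hn00 (fun n => lt0r_neq0 (hn0 n)).
apply: le_trans (Re_le_modulus _); apply: le_trans (ler_norm _).
have hc : (fun=> f a * tail_mass a / (20 * (1 - a) ^+ 2)) @ \oo -->
  f a * tail_mass a / (20 * (1 - a) ^+ 2) by exact: cvg_cst.
apply: (ler_cvg_to hc hlim); apply: nearW => n /=.
have -> : (hn n)%:C + z = (x + hn n) +i* y by apply/eqP; rewrite eq_complex /z /= add0r addrC !eqxx.
have hI : 0 < hn n <= (1 - a) / 4 by rewrite hn0 hn1.
have w1 : modulus ((x + hn n) +i* y : C) < 1 by apply: disc; rewrite ltW ?hn0 ?hn1.
have a01 : 0 <= a < 1 by apply/andP; split; lra.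
have k0 : 0 <= hn n / (20 * (1 - a) ^+ 2).
  by rewrite divr_ge0 ?(ltW (hn0 n))// mulr_ge0// sqr_ge0.
have inc := hankel_Re_increment z1 w1 a01 k0
  (fun t tI => cauchy_re_increment tI aI xI yI hI).
rewrite -/H in inc; set w : C := _ +i* y in inc *.
rewrite ler_pdivlMl//; apply: le_trans inc.
by rewrite le_eqVlt; apply/orP; left; apply/eqP; ring.
Qed.

End HankelIncrement.


(** * From pointwise growth to the Besov seminorm *)

Section LowerBound.
Variable R : realType.
Local Notation C := R[i]^o.
Implicit Types (p a x y : R).

Definition lower_const p : R := pi^-1 * ((4 `^ `|p - 2|)^-1 / 16).

Lemma lower_const_gt0 p : 0 < lower_const p.
Proof. by rewrite mulr_gt0 ?invr_gt0 ?pi_gt0// divr_gt0// invr_gt0 powR_gt0. Qed.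

(** The rectangle has area (1 - a) ^ 2 / 16 and its points are at distance
    comparable to 1 - a from the unit circle, so the weight is comparable to
    (1 - a) ^ (p - 2) there. *)
Lemma area_integral_ge p a kappa (g : C -> C) : 1 < p -> 2^-1 <= a < 1 -> 0 <= kappa ->
  (forall x y, a <= x <= (1 + a) / 2 -> 0 <= y <= (1 - a) / 8 ->
     kappa <= modulus (derive1 g (x +i* y))) ->
  ((lower_const p * (kappa * (1 - a)) `^ p)%:E <=
   area_integral_disc (besov_density p g))%E.
Proof.
move=> p1 /andP[ah a1] k0 hk; set q := (4 `^ `|p - 2| : R).
have a0 : 0 < 1 - a by lra.
have q0 : 0 < q by rewrite powR_gt0.
pose b : R := q^-1 * (1 - a) `^ (p - 2) * kappa `^ p.
have b0 : 0 <= b by rewrite !mulr_ge0 ?powR_ge0// invr_ge0 ltW.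
pose Q : set (measurableTypeR R * measurableTypeR R) :=
  `[a, (1 + a) / 2]%classic `*` `[0, (1 - a) / 8]%classic.
have mQ : measurable Q by apply: measurableX; exact: measurable_itv.
have muQ : (lebesgue_measure \x lebesgue_measure)%E Q = (((1 - a) ^+ 2) / 16)%:E.
  rewrite product_measure1E; try exact: measurable_itv.
  have l1 : lebesgue_measure (`[a, (1 + a) / 2]%classic : set R) = ((1 + a) / 2 - a)%:E.
    by rewrite lebesgue_measure_itv/= lte_fin ifT -?EFinB//; lra.
  have l2 : lebesgue_measure (`[0, (1 - a) / 8]%classic : set R) = ((1 - a) / 8 - 0)%:E.
    by rewrite lebesgue_measure_itv/= lte_fin ifT -?EFinB//; lra.
  transitivity (((1 + a) / 2 - a)%:E * ((1 - a) / 8 - 0)%:E)%E.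
    by congr (_ * _)%E; [exact: l1|exact: l2].
  by rewrite -EFinM; congr EFin; field.
have disc x y : a <= x <= (1 + a) / 2 -> 0 <= y <= (1 - a) / 8 ->
    (1 - a) / 4 <= 1 - (x ^+ 2 + y ^+ 2) <= 4 * (1 - a).
  move=> /andP[ax xa] /andP[y0 ya].
  have b2 : x ^+ 2 <= ((1 + a) / 2) ^+ 2 by rewrite lerXn2r ?nnegrE; lra.
  have b3 : y ^+ 2 <= ((1 - a) / 8) ^+ 2 by rewrite lerXn2r ?nnegrE; lra.
  have b4 : 0 < (1 - a) * (1 - a) by rewrite mulr_gt0; lra.
  have b5 : (1 - a) * (1 - a) <= (1 - a) * 2^-1 by rewrite ler_pM2l; lra.
  have b6 : a ^+ 2 <= x ^+ 2 by rewrite lerXn2r ?nnegrE; lra.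
  have b7 := sqr_ge0 y.
  have b8 := lerD b2 b3.
  apply/andP; split; lra.
rewrite /area_integral_disc /lower_const -mulrA EFinM; apply: lee_wpmul2l.
  by rewrite lee_fin invr_ge0 pi_ge0.
apply: (@le_trans _ _ (\int[lebesgue_measure \x lebesgue_measure]_(w in Q) cst b%:E w)%E).
  rewrite integral_cst// [X in (_ <= _ * X)%E]muQ -EFinM lee_fin /b -/q.
  have -> : (kappa * (1 - a)) `^ p = kappa `^ p * ((1 - a) `^ (p - 2) * (1 - a) ^+ 2).
    rewrite powRM ?(ltW a0)//; congr (_ * _).
    rewrite -powR_mulrn ?(ltW a0)// -powRD; first by congr (_ `^ _); ring.
    by rewrite (gt_eqF a0) implybT.
  by rewrite le_eqVlt; apply/orP; left; apply/eqP; ring.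
rewrite integral_mkcond [leRHS]integral_mkcond.
apply: ge0_le_integral_nomeas => -[x y] _.
  by apply: erestrict_ge0 => w _; rewrite lee_fin.
have dg0 w : (0 <= (besov_density p g w)%:E)%E by rewrite lee_fin mulr_ge0 ?powR_ge0.
rewrite !patchE; case: ifPn => [|_]; last by case: ifPn.
rewrite inE => -[/=]; rewrite !in_itv/= => xI yI.
have /andP[d1 d2] := disc x y xI yI.
rewrite ifT; last by rewrite inE /unit_disc/=; lra.
rewrite lee_fin /besov_density modulus_sqr/= /b.
apply: ler_pM => //.
- by rewrite mulr_ge0 ?powR_ge0// invr_ge0 ltW.
- by rewrite powR_ge0.
- set r := 1 - (x ^+ 2 + y ^+ 2) in d1 d2 *.
  have r0 : 0 < r by lra.
  have -> : r = (r / (1 - a)) * (1 - a) by rewrite mulfVK// gt_eqF.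
  rewrite powRM; [|by rewrite divr_ge0; lra|lra].
  rewrite ler_wpM2r ?powR_ge0//.
  set v := r / (1 - a).
  have v0 : 0 < v by rewrite divr_gt0.
  rewrite -[p - 2]opprK powRN lef_pV2 ?posrE ?powR_gt0//.
  rewrite /q -normrN; apply: powR_le_of_bounds; first lra.
  by rewrite /v ler_pdivlMr// ler_pdivrMr//; lra.
- apply: ge0_ler_powR; rewrite ?nnegrE ?modulus_ge0//; first lra.
  exact: hk.
Qed.

End LowerBound.

(** * Conclusion *)

Section Conclusion.
Variable R : realType.
Implicit Types (p a t : R) (J : nat).

Lemma dyadic_scale t : 2^-1 <= t < 1 ->
  exists J, [/\ (0 < J)%N, 1 - t <= dyad R J & dyad R J.+1 < 1 - t].
Proof.
move=> /andP[th t1].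
have ex : exists n, dyad R n < 1 - t.
  have : (fun n => 2^-1 ^+ n) @ \oo --> (0 : R).
    by apply: cvg_expr; rewrite ger0_norm ?invr_ge0// invf_lt1// ltr1n.
  move=> /cvgrPdist_lt/(_ (1 - t)); rewrite subr_gt0 => /(_ t1).
  move=> -[n _ /(_ n (leqnn n))] /=; rewrite sub0r normrN ger0_norm ?exprn_ge0 ?invr_ge0// => h.
  by exists n.
have [n hn nmin] := ex_minnP ex.
case: n hn nmin => [|[|J]] hn nmin.
- by move: hn; rewrite /dyad expr0; lra.
- by move: hn; rewrite /dyad expr1; lra.
- exists J.+1; split => //.
  by rewrite leNgt; apply/negP => /nmin; rewrite ltnn.
Qed.

(** Boundedness compares J * mu [a, 1) / (1 - a), the lower bound for the seminorm
    of the image, with J ^ (1 / p), the norm of the test function. *)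
Lemma carleson_dyadic p (mu : {finite_measure set (measurableTypeR R) -> \bar R}) :
  1 < p -> hankel_bounded_on_besov mu p ->
  exists2 D : R, 0 <= D & forall J a, (0 < J)%N -> 2^-1 <= a < 1 ->
    1 - a <= dyad R J -> J%:R `^ (1 - p^-1) * tail_mass mu a <= D * (1 - a).
Proof.
move=> p1 [M hM].
pose K : R := 1 + (pi^-1 * (test_bound p * (16 / (p - 1)))) `^ p^-1.
have K0 : 0 <= K by rewrite addr_ge0 ?powR_ge0.
pose l : R := lower_const p `^ p^-1.
have l0 : 0 < l by rewrite powR_gt0 ?lower_const_gt0.
exists (40 * `|M| * K / l).
  by rewrite divr_ge0 ?(ltW l0)// !mulr_ge0.
move=> J a J0 aI aJ; have /andP[ah a1] := aI.
have a0 : 0 < 1 - a by lra.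
set m := tail_mass mu a.
have m0 : 0 <= m by apply: fine_ge0; exact: measure_ge0.
have [bf nf] := test_besov p1 J0.
have [wd bg ng] := hM _ _ bf (@has_expansion_test_fun R J).
set g := hankel mu _ in bg ng.
have J1 : 0 < J%:R :> R by rewrite ltr0n.
pose kappa := J%:R / 2 * m / (20 * (1 - a) ^+ 2).
have k0 : 0 <= kappa.
  by rewrite divr_ge0 ?mulr_ge0 ?sqr_ge0// ltW.
have hk x y : a <= x <= (1 + a) / 2 -> 0 <= y <= (1 - a) / 8 ->
    kappa <= modulus (derive1 g (x +i* y)).
  move=> xI yI; apply: le_trans (hankel_derive_ge wd aI xI yI).
  apply: ler_wpM2r; first by rewrite invr_ge0 mulr_ge0// sqr_ge0.
  by apply: ler_wpM2r => //; exact: test_real_ge.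
have low := area_integral_ge p1 aI k0 hk.
have pv0 : 0 <= p^-1 by rewrite invr_ge0; lra.
have low2 : ((l * (kappa * (1 - a)))%:E <= besov_seminorm p g)%E.
  have ka0 : 0 <= kappa * (1 - a) by rewrite mulr_ge0// ltW.
  have -> : l * (kappa * (1 - a)) = (lower_const p * (kappa * (1 - a)) `^ p) `^ p^-1.
    rewrite powRM ?powR_ge0 ?(ltW (lower_const_gt0 p))//; congr (_ * _).
    by rewrite -powRrM mulfV ?powRr1//; lra.
  rewrite -poweR_EFin; apply: gt0_ler_poweR => //.
    by rewrite in_itv/= leey lee_fin mulr_ge0 ?powR_ge0// ltW// lower_const_gt0.
  by rewrite in_itv/= leey area_integral_besov_ge0.
have up : (besov_seminorm p g <= (`|M| * (K * J%:R `^ p^-1))%:E)%E.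
  apply: (@le_trans _ _ (besov_norm p g)).
    by rewrite leeDr// lee_fin modulus_ge0.
  apply: (le_trans ng); rewrite EFinM.
  apply: (@le_trans _ _ (`|M|%:E * besov_norm p (test_fun J))%E).
    apply: lee_wpmul2r; last by rewrite lee_fin ler_norm.
    by rewrite adde_ge0 ?poweR_ge0// lee_fin modulus_ge0.
  by apply: lee_wpmul2l; rewrite ?lee_fin.
have := le_trans low2 up; rewrite lee_fin => main.
have ek : kappa * (1 - a) = J%:R * m / (40 * (1 - a)).
  by rewrite /kappa; field; rewrite gt_eqF.
rewrite ek in main.
have Jp0 : 0 < J%:R `^ p^-1 :> R by rewrite powR_gt0.
have eJ : J%:R = J%:R `^ (1 - p^-1) * J%:R `^ p^-1 :> R.
  by rewrite -powRD ?subrK ?powRr1 ?(ltW J1)// (gt_eqF J1) implybT.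
rewrite -(ler_pM2r Jp0) mulrAC -eJ -(ler_pM2l l0).
have : l * (J%:R * m / (40 * (1 - a))) * (40 * (1 - a)) <=
    `|M| * (K * J%:R `^ p^-1) * (40 * (1 - a)).
  by rewrite ler_wpM2r// mulr_ge0// ltW.
have -> : l * (J%:R * m / (40 * (1 - a))) * (40 * (1 - a)) = l * (J%:R * m).
  by field; rewrite gt_eqF.
move=> /le_trans; apply.
rewrite le_eqVlt; apply/orP; left; apply/eqP; field.
by rewrite gt_eqF.
Qed.

End Conclusion.

Theorem theorem1p4 (R : realType) (p : R)
    (mu : {finite_measure set (measurableTypeR R) -> \bar R}) :
  1 < p ->
  concentrated_on_01 mu ->
  hankel_bounded_on_besov mu p ->
  log_carleson mu (1 - p^-1) 1.
Proof.
move=> p1 _ hb; have [D D0 hD] := carleson_dyadic p1 hb.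
set al := 1 - p^-1.
have pv : 0 < p^-1 < 1 by rewrite invr_gt0 invf_lt1; lra.
have al0 : 0 <= al by rewrite /al; lra.
have al1 : al <= 1 by rewrite /al; lra.
pose T := fine (mu `[0%R, 1%R[%classic).
have T0 : 0 <= T by apply: fine_ge0; exact: measure_ge0.
have l2 : ln 2 <= 1 :> R.
  by have := @le_ln1Dx R 1; rewrite -[1 + 1]/2; apply.
exists (2 * T + 2 * D + 1); first lra.
move=> t /andP[t0 t1]; rewrite powRr1; last lra.
set m := tail_mass mu t.
have mE : mu `[t, 1%R[%classic = m%:E.
  by rewrite /m /tail_mass fineK// fin_num_measure//; exact: measurable_itv.
have m0 : 0 <= m by apply: fine_ge0; exact: measure_ge0.
rewrite [X in (X * _ <= _)%E]mE -EFinM lee_fin.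
have ln0 : 0 <= ln (1 - t)^-1.
  by rewrite ln_ge0// invf_ge1; lra.
(* For t < 1 / 2 the logarithm is at most 1 and the total mass is enough. *)
have [th|th] := ltP t 2^-1.
  have lnle : ln (1 - t)^-1 <= 1.
    apply: le_trans l2; rewrite ler_ln ?posrE ?invr_gt0//; last lra.
    by rewrite -[leRHS]invrK lef_pV2 ?posrE; lra.
  have pw1 : ln (1 - t)^-1 `^ al <= 1.
    apply: (@le_trans _ _ (1 `^ al)); last by rewrite powR1.
    by apply: ge0_ler_powR; rewrite ?nnegrE.
  have mT : m <= T.
    apply: fine_le; rewrite ?fin_num_measure//; try exact: measurable_itv.
    apply: le_measure; rewrite ?inE; try exact: measurable_itv.
    by move=> s; rewrite /= !in_itv/=; lra.
  have pw0 := powR_ge0 (ln (1 - t)^-1) al.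
  have : m * ln (1 - t)^-1 `^ al <= T by rewrite -[leRHS]mulr1 ler_pM.
  move=> /le_trans; apply.
  have : (2 * T + 2 * D + 1) * 2^-1 <= (2 * T + 2 * D + 1) * (1 - t).
    by rewrite ler_wpM2l; lra.
  lra.
have tI : 2^-1 <= t < 1 by rewrite th.
(* The number J of scales is comparable to ln (1 / (1 - t)). *)
have [J [J0 tJ Jt]] := dyadic_scale tI.
have J1 : 0 < J%:R :> R by rewrite ltr0n.
have lnle : ln (1 - t)^-1 <= 2 * J%:R.
  apply: (@le_trans _ _ (ln (2 ^+ J.+1))).
    rewrite ler_ln ?posrE ?exprn_gt0 ?invr_gt0//; last lra.
    rewrite -[leRHS]invrK lef_pV2 ?posrE ?invr_gt0 ?exprn_gt0//; last lra.
    by rewrite -exprVn ltW.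
  rewrite lnXn// -[ln 2 *+ _]mulr_natl.
  have J2 : J.+1%:R <= 2 * J%:R :> R.
    by rewrite -natrM ler_nat mul2n -addnn -addn1 leq_add2l.
  by apply: le_trans J2; rewrite ler_piMr.
have pw : ln (1 - t)^-1 `^ al <= 2 * J%:R `^ al.
  apply: (@le_trans _ _ ((2 * J%:R) `^ al)).
    by apply: ge0_ler_powR; rewrite ?nnegrE// mulr_ge0// ltW.
  rewrite powRM ?(ltW J1)// ler_wpM2r ?powR_ge0//.
  by apply: ler1_powR => //; rewrite ler1n.
have := hD J t J0 tI tJ; rewrite -/m -/al => hJ.
apply: (@le_trans _ _ (m * (2 * J%:R `^ al))); first by rewrite ler_wpM2l.
apply: (@le_trans _ _ (2 * D * (1 - t))); first lra.
by rewrite ler_wpM2r; lra.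
Qed.
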